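(* Let $V\in\mathbb{V}_2^{\mathrm o}(\mathbb{R}^3)$ be an oriented $2$-varifold and $H\in L^2_{\mathrm{loc}}(\mu_V;\mathbb{R}^3)$ such that $\delta V(X)=-\int_{\mathbb{R}^3}\langle X,H\rangle\,d\mu_V$ for all $X\in C^1_c(\mathbb{R}^3;\mathbb{R}^3)$ and $H(x)\wedge\star\xi=0$ for $V$-almost all $(x,\xi)$. Suppose $\operatorname{spt}\mu_V$ is compact, $c_0<0$, and $x_0\in\mathbb{R}^3$ is such that $\theta^{*2}(\mu_V,x_0)\ge1$ and $\mathcal{V}_c(V,x_0)>0$. Then $$\mathcal{H}_{c_0}(V)>4\pi.$$
   Context: $\mathbb{G}^{\mathrm o}(3,2)=\{\xi\in\bigwedge_2\mathbb{R}^3:\ \xi\text{ simple},\ |\xi|=1\}$; $T(\xi)=\{v\in\mathbb{R}^3:v\wedge\xi=0\}$; $\star\xi\in\mathbb{S}^2$ is the Hodge dual ($\star(v_1\wedge v_2)=v_1\times v_2$). An oriented $2$-varifold on $\mathbb{R}^3$ is a Radon measure $V$ on $\mathbb{G}_2^{\mathrm o}(\mathbb{R}^3)=\mathbb{R}^3\times\mathbb{G}^{\mathrm o}(3,2)$ (set of these: $\mathbb{V}_2^{\mathrm o}(\mathbb{R}^3)$), with weight measure $\mu_V$ the push forward of $V$ to $\mathbb{R}^3$, and first variation $\delta V(X)=\int\operatorname{div}_{T(\xi)}X(x)\,dV(x,\xi)$, where $\operatorname{div}_TX=\sum_{j=1}^2\langle e_j,DX\,e_j\rangle$ for an orthonormal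 basis $e_1,e_2$ of $T$. The Helfrich energy is $\mathcal{H}_{c_0}(V)=\frac14\int|H(x)-c_0(\star\xi)|^2\,dV(x,\xi)\in[0,\infty]$; the concentrated volume is $\mathcal{V}_c(V,x_0)=-\int\frac{\langle x-x_0,\star\xi\rangle}{|x-x_0|^2}\,dV(x,\xi)$; the upper density is $\theta^{*2}(\mu_V,x)=\limsup_{\rho\to0+}\mu_V(B_\rho(x))/(\pi\rho^2)$ with closed balls $B_\rho(x)$. *)

(* Defs.v *)
(* Oriented 2-varifolds on R^3, over MathComp-Analysis; R^3 is ['rV[R]_3].
   The norm which MathComp-Analysis puts on ['rV[R]_3] is the sup norm, so it is
   used only for its topology and derivatives; all metric notions below are
   built from the Euclidean [enorm]. *)
From HB Require Import structures.
From mathcomp Require Import all_boot all_order all_algebra.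
From mathcomp Require Import all_classical all_reals all_analysis.
Set Implicit Arguments.
Unset Strict Implicit.
Unset Printing Implicit Defensive.
Import Order.TTheory GRing.Theory Num.Theory.
Import numFieldNormedType.Exports.
Local Open Scope classical_set_scope.
Local Open Scope ring_scope.

Section euclidean.
Context {R : realType}.
Implicit Types (u v : 'rV[R]_3) (xi : 'M[R]_3).

Definition dot u v : R := \sum_(i < 3) u 0 i * v 0 i.

Definition enorm u : R := Num.sqrt (dot u u).

Definition eball u (rho : R) : set 'rV[R]_3 := [set v | enorm (v - u) <= rho].

Definition cross u v : 'rV[R]_3 :=
  \row_i [:: u 0 1 * v 0 2 - u 0 2 * v 0 1;
             u 0 2 * v 0 0 - u 0 0 * v 0 2;
             u 0 0 * v 0 1 - u 0 1 * v 0 0]`_i.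

(* A 2-vector \sum_(i < j) xi_ij e_i /\ e_j is encoded by the antisymmetric
   matrix of its coefficients xi_ij. *)
Definition wedge u v : 'M[R]_3 :=
  \matrix_(i, j) (u 0 i * v 0 j - u 0 j * v 0 i).

Definition simple2 xi : Prop := exists u v, xi = wedge u v.

(* The norm of \bigwedge_2 R^3 making (e_i /\ e_j)_(i < j) orthonormal. *)
Definition norm2 xi : R :=
  Num.sqrt (\sum_(i < 3) \sum_(j < 3 | (i < j)%N) xi i j ^+ 2).

(* The coefficient of v /\ xi on e_0 /\ e_1 /\ e_2. *)
Definition wedge12 v xi : R :=
  v 0 0 * xi 1 2 - v 0 1 * xi 0 2 + v 0 2 * xi 0 1.

Definition tangent xi : set 'rV[R]_3 := [set v | wedge12 v xi = 0].

Definition hodge xi : 'rV[R]_3 :=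
  \row_i [:: xi 1 2; xi 2 0; xi 0 1]`_i.

Lemma hodge_wedge u v : hodge (wedge u v) = cross u v.
Proof. by apply/rowP => -[[|[|[|]]]] //= ?; rewrite !mxE /= ?mxE. Qed.

Definition orthonormal_basis (T : set 'rV[R]_3) (e : 'M[R]_(2, 3)) : Prop :=
  (forall j k, dot (row j e) (row k e) = (j == k)%:R) /\
  T = [set v | (v <= e)%MS].

(* The value does not depend on which orthonormal basis of T is selected. *)
Definition tdiv (T : set 'rV[R]_3) (X : 'rV[R]_3 -> 'rV[R]_3) x : R :=
  let e := xget 0 (orthonormal_basis T) in
  \sum_(j < 2) dot (row j e) ('d X x (row j e)).

Definition C1c (X : 'rV[R]_3 -> 'rV[R]_3) : Prop :=
  [/\ forall x, differentiable X x,
      continuous (fun x => 'J X x) &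
      compact (closure [set x | X x != 0])].

End euclidean.

Section grassmannian.
Variable R : realType.

Definition oGrass_set : set 'M[R]_3 := [set xi | simple2 xi /\ norm2 xi = 1].

Definition oGrass : Type := set_type oGrass_set.

Lemma oGrass_nonempty : oGrass_set (wedge (delta_mx 0 0) (delta_mx 0 1)).
Proof.
split; first by exists (delta_mx 0 0), (delta_mx 0 1).
rewrite /norm2 [X in Num.sqrt X](_ : _ = 1) ?sqrtr1 //.
under eq_bigr do rewrite big_mkcond !big_ord_recl big_ord0.
rewrite !big_ord_recl big_ord0 /= !mxE /=.
by rewrite !(mulr0, mulr1, subr0, oppr0, expr0n, expr1n, addr0, add0r).
Qed.

HB.instance Definition _ := Topological.on oGrass.
HB.instance Definition _ :=
  isPointed.Build oGrass
    (exist (fun xi => xi \in oGrass_set) _ (mem_set oGrass_nonempty)).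

End grassmannian.

HB.instance Definition _ (T U : ptopologicalType) := Pointed.on (T * U)%type.

Notation borel T := (g_sigma_algebraType (open : set (set T))).

Definition radon (R : realType) (T : ptopologicalType)
    (mu : {measure set (borel T) -> \bar R}) : Prop :=
  [/\ forall K : set T, compact K -> (mu K < +oo)%E,
      forall U : set T, open U ->
        mu U = ereal_sup [set mu K | K in [set K : set T | compact K /\ K `<=` U]] &
      forall A : set (borel T), measurable A ->
        mu A = ereal_inf [set mu U | U in [set U : set T | open U /\ A `<=` U]]].

Definition E3 (R : realType) := borel 'rV[R]_3.
Definition G2o (R : realType) := borel ('rV[R]_3 * oGrass R).
HB.instance Definition _ R := Measurable.on (E3 R).
HB.instance Definition _ R := Measurable.on (G2o R).

Section varifold.
Context {R : realType}.

Definition base (p : G2o R) : E3 R := p.1.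

Definition plane (p : G2o R) : 'M[R]_3 := set_val p.2.

Lemma measurable_base : measurable_fun setT base.
Proof.
refine (@measurability _ _ (G2o R) (E3 R) setT base
  (open : set (set 'rV[R]_3)) _ _) => //.
move=> _ [U oU <-]; rewrite setTI; apply: sub_sigma_algebra.
by apply: open_comp oU => x _; exact: cvg_fst.
Qed.

HB.instance Definition _ :=
  isMeasurableFun.Build _ _ (G2o R) (E3 R) base measurable_base.

Variable V : {measure set (G2o R) -> \bar R}.

Definition weight : set (E3 R) -> \bar R := pushforward V base.

Let weight0 : weight set0 = 0%E.
Proof. exact: measure0. Qed.

Let weight_ge0 A : (0 <= weight A)%E.
Proof. exact: measure_ge0. Qed.

Let weight_sigma_additive : semi_sigma_additive weight.
Proof. exact: measure_semi_sigma_additive. Qed.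

HB.instance Definition _ := isMeasure.Build _ (E3 R) R weight
  weight0 weight_ge0 weight_sigma_additive.

End varifold.

Section varifold_functionals.
Context {R : realType}.
Implicit Types (mu : {measure set (E3 R) -> \bar R})
  (V : {measure set (G2o R) -> \bar R}) (H X : E3 R -> E3 R).
Local Open Scope ereal_scope.

Definition spt mu : set 'rV[R]_3 :=
  ~` \bigcup_(U in [set U : set 'rV[R]_3 | open U /\ mu U = 0]) U.

Definition L2loc mu H : Prop :=
  measurable_fun [set: E3 R] H /\
  forall K : set 'rV[R]_3, compact K ->
    \int[mu]_(x in K) ((enorm (H x) ^+ 2)%R)%:E < +oo.

Definition upper_density2 mu (x0 : 'rV[R]_3) : \bar R :=
  limf_esup (fun rho : R => mu (eball x0 rho) * ((pi * rho ^+ 2)^-1)%:E)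
    (0%R : R)^'+.

Definition first_variation V X : \bar R :=
  \int[V]_p (tdiv (tangent (plane p)) X (base p))%:E.

Definition helfrich (c0 : R) V H : \bar R :=
  (4^-1)%:E *
  \int[V]_p ((enorm (H (base p) - c0 *: hodge (plane p)) ^+ 2)%R)%:E.

(* The integrand is 0 where [base p = x0], because [x / 0 = 0]. *)
Definition conc_volume V (x0 : 'rV[R]_3) : \bar R :=
  - \int[V]_p (dot (base p - x0) (hodge (plane p))
                / enorm (base p - x0) ^+ 2)%:E.

End varifold_functionals.

(* Main.v *)
Require Import Defs.
From HB Require Import structures.
From mathcomp Require Import all_boot all_order all_algebra.
From mathcomp Require Import all_classical all_reals all_analysis.
From mathcomp Require Import finmap measurable_realfun ring lra.
Set Implicit Arguments.
Unset Strict Implicit.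
Unset Printing Implicit Defensive.
Import Order.TTheory GRing.Theory Num.Theory.
Import numFieldNormedType.Exports.
Local Open Scope classical_set_scope.
Local Open Scope ring_scope.

(* Write s = |x - x0|^2, nu for the Hodge dual of the tangent plane at x,
   beta = <x - x0, nu>, b = beta / s and H = h nu.  Testing the first variation
   with phi(s) (x - x0), where phi(s) = (e^N + s^N)^(-1/N) and u = s phi(s),
   gives
     int 2 phi (1 - u^N) + 2 u^(N+1) b^2 = - int u b h.
   The left-hand side dominates 2 int u b^2, so int u b^2 <= int h^2 / 4, and
   e -> 0 shows that b is square integrable.  By dominated convergence
   2 int phi (1 - u^N) then tends to L = - int (b h + 2 b^2) as e -> 0, for
   every N.  As N grows, phi (1 - u^N) approaches e^-1 times the indicator
   function of {s <= e}, so that the density hypothesis forces L >= 2 pi.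
   Integrating (h - c0)^2 / 8 + b (h - c0) + 2 b^2 >= 0 (twice a square) yields
     helfrich / 2 >= L + c0 int b >= 2 pi + c0 int b > 2 pi,
   because c0 < 0 and int b = - conc_volume < 0. *)

(** * The radial profile *)

Section profile.
Context {R : realType}.
Implicit Types (n : nat) (e s l : R).

(* The exponent is an even number N, so that the base is positive for every s.
   The function s * profile n e s = (1 + (e / s)^N)^(-1/N) increases from 0 to 1
   and is a smoothing of min(s / e, 1). *)
Definition profile n e s : R :=
  (e ^+ n.+1.*2 + s ^+ n.+1.*2) `^ (- (n.+1.*2%:R)^-1).

Lemma profile_base_gt0 n e s : 0 < e -> 0 < e ^+ n.+1.*2 + s ^+ n.+1.*2.
Proof.
by move=> e0; rewrite ltr_wpDr ?exprn_gt0// exprn_even_ge0// odd_double.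
Qed.

Lemma profile_gt0 n e s : 0 < e -> 0 < profile n e s.
Proof. by move=> e0; rewrite powR_gt0// profile_base_gt0. Qed.

(** This polynomial relation eliminates the real power: with u = s phi and v = e phi it reads u^N +
    v^N = 1. The bounds below follow from it. *)
Lemma profileX n e s : 0 < e ->
  profile n e s ^+ n.+1.*2 * (e ^+ n.+1.*2 + s ^+ n.+1.*2) = 1.
Proof.
move=> e0; have b0 := profile_base_gt0 n s e0.
rewrite -powR_mulrn ?ltW ?profile_gt0// /profile -powRrM mulNr.
by rewrite mulVf ?pnatr_eq0// powR_inv1 ?ltW// mulVf// gt_eqF.
Qed.

Lemma profile_le n e s : 0 < e -> e * profile n e s <= 1.
Proof.
move=> e0; have p0 := profile_gt0 n s e0.
rewrite -(@expr_le1 _ n.+1.*2)//; last by rewrite mulr_ge0// ltW.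
rewrite exprMn mulrC -[leRHS](profileX n s e0) ler_wpM2l ?exprn_ge0 ?(ltW p0)//.
by rewrite lerDl exprn_even_ge0// odd_double.
Qed.

Lemma profile_mul_le n e s : 0 < e -> 0 <= s -> s * profile n e s <= 1.
Proof.
move=> e0 s0; have p0 := profile_gt0 n s e0.
rewrite -(@expr_le1 _ n.+1.*2)//; last by rewrite mulr_ge0// ltW.
rewrite exprMn mulrC -[leRHS](profileX n s e0) ler_wpM2l ?exprn_ge0 ?(ltW p0)//.
by rewrite lerDr exprn_ge0// ltW.
Qed.

Lemma profileB n e s : 0 < e ->
  1 - (s * profile n e s) ^+ n.+1.*2 = (e * profile n e s) ^+ n.+1.*2.
Proof.
by move=> e0; rewrite -{1}(profileX n s e0) !exprMn; ring.
Qed.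

(** With v = e phi the right-hand side is v * v^N. The relation [profileX] gives v^N >= 1 / (1 +
    l^N), and v >= v^N because v <= 1, so each of the two factors is at least 1 / (1 + l^N). The
    bound is not sharp, but it tends to 1 as N grows when l < 1. *)
Lemma profile_lower n e s l : 0 < e -> 0 <= s -> 0 <= l -> s <= l * e ->
  (1 + l ^+ n.+1.*2) ^- 2 <=
  e * (profile n e s * (1 - (s * profile n e s) ^+ n.+1.*2)).
Proof.
move=> e0 s0 l0 sle; rewrite profileB// mulrA.
have p0 := profile_gt0 n s e0.
have ep1 := profile_le n s e0.
have ep0 : 0 <= e * profile n e s by rewrite mulr_ge0// ltW.
have l1 : 0 < 1 + l ^+ n.+1.*2 by rewrite ltr_pwDl// exprn_ge0.
have H : (1 + l ^+ n.+1.*2)^-1 <= (e * profile n e s) ^+ n.+1.*2.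
  rewrite -[leLHS]mul1r ler_pdivrMr// -{1}(profileX n s e0) exprMn.
  rewrite [X in _ <= X * _]mulrC -[leRHS]mulrA ler_pM2l ?exprn_gt0//.
  by rewrite mulrDr mulr1 lerD2l -exprMn mulrC lerXn2r// nnegrE ?mulr_ge0// ltW.
rewrite -exprVn expr2 ler_pM ?invr_ge0 ?(ltW l1)//.
by apply: le_trans H _; rewrite doubleS exprS ler_piMr// exprn_ile1.
Qed.

Lemma is_derive_profile n e s : 0 < e ->
  is_derive s 1 (profile n e)
    (- (s ^+ n.+1.*2.-1 * profile n e s ^+ n.+1.*2.+1)).
Proof.
move=> e0; have b0 := profile_base_gt0 n s e0.
have p0 := profile_gt0 n s e0.
set N := n.+1.*2.
have dX : is_derive s 1 (fun t : R => e ^+ N + t ^+ N) (N%:R * s ^+ N.-1).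
  have -> : (fun t : R => e ^+ N + t ^+ N) = cst (e ^+ N) + id ^+ n.*2.+2.
    by apply/funext => t; rewrite !fctE.
  apply: is_derive_eq.
  by rewrite add0r /GRing.scale/= mulr1 /N doubleS.
have dP := @is_derive1_powR _ (- N%:R^-1) _ b0.
have -> : - (s ^+ N.-1 * profile n e s ^+ N.+1) =
    (- N%:R^-1 * (e ^+ N + s ^+ N) `^ (- N%:R^-1 - 1)) * (N%:R * s ^+ N.-1).
  2: exact: (@is_derive1_comp _ (fun t : R => t `^ (- N%:R^-1))
    (fun t : R => e ^+ N + t ^+ N)).
rewrite powRD; last by apply/implyP => _; rewrite gt_eqF.
rewrite -[_ `^ (- N%:R^-1)]/(profile n e s) powR_inv1 ?ltW//.
(* The power -1/N - 1 of the base splits as phi times the inverse of the base, and that inverse is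
   phi^N; hence phi' = - s^(N-1) phi^(N+1). *)
have -> : (e ^+ N + s ^+ N)^-1 = profile n e s ^+ N.
  by apply: (mulIf (lt0r_neq0 b0)); rewrite mulVf ?gt_eqF// profileX.
rewrite exprS.
have N0 : N%:R != 0 :> R by rewrite pnatr_eq0.
by rewrite /=; field.
Qed.

End profile.

(** * Convergence of the profile as e tends to 0 *)

Section profile_limit.
Context {R : realType}.

Lemma cvg_exprn (F : set_system nat) (FF : Filter F) (f : R^nat) (a : R) m :
  f @ F --> a -> (fun k => f k ^+ m) @ F --> a ^+ m.
Proof.
move=> fa; apply: (cvg_comp f (fun x : R => x ^+ m) fa).
exact: exprn_continuous.
Qed.

(** Since u = s phi and v = e phi lie in [0, 1], u + v >= u^N + v^N = 1; moreover u <= 1 gives phi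
    <= 1 / s, hence v <= e / s. *)
Lemma profile_mulB_le n (e s : R) : 0 < e -> 0 < s ->
  1 - e / s <= s * profile n e s.
Proof.
move=> e0 s0; have p0 := profile_gt0 n s e0.
have u0 : 0 <= s * profile n e s by rewrite mulr_ge0// ltW.
have u1 := profile_mul_le n e0 (ltW s0).
have v0 : 0 <= e * profile n e s by rewrite mulr_ge0// ltW.
have v1 := profile_le n s e0.
have vs : e * profile n e s <= e / s.
  by rewrite ler_wpM2l ?(ltW e0)// -[leRHS]mul1r ler_pdivlMr// mulrC.
have := profileB n s e0.
have : (e * profile n e s) ^+ n.+1.*2 <= e * profile n e s.
  by rewrite doubleS exprS ler_piMr// exprn_ile1.
have : (s * profile n e s) ^+ n.+1.*2 <= s * profile n e s.
  by rewrite doubleS exprS ler_piMr// exprn_ile1.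
lra.
Qed.

Lemma cvg_profile_mul n (e : R^nat) (s : R) :
  (forall k, 0 < e k) -> e @ \oo --> 0 -> 0 < s ->
  (fun k => s * profile n (e k) s) @ \oo --> (1 : R).
Proof.
move=> e0 ecvg s0.
apply: (@squeeze_cvgr _ _ _ _ (fun k => 1 - e k / s) (cst 1)).
- near=> k; rewrite profile_mulB_le//=.
  by rewrite profile_mul_le// ltW.
- rewrite -[X in _ --> X](_ : 1 - 0 / s = 1); last by rewrite mul0r subr0.
  by apply: cvgB; [exact: cvg_cst|exact: cvgMl].
- exact: cvg_cst.
Unshelve. all: end_near. Qed.

End profile_limit.

(** * The monotonicity argument on an abstract measure space *)

Section monotonicity.
Context d (T : measurableType d) (R : realType).
Variable mu : {measure set T -> \bar R}.
Variables (s beta h : T -> R).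
Hypotheses (mufin : (mu setT < +oo)%E).
Hypotheses (ms : measurable_fun setT s) (mbeta : measurable_fun setT beta)
  (mh : measurable_fun setT h).
Hypotheses (s0 : forall x, 0 <= s x) (betas : forall x, beta x ^+ 2 <= s x).

Local Notation I f := (mu.-integrable setT (EFin \o f)).
Hypothesis h2 : I (fun x => h x ^+ 2).

Let phi n (e : R) x := profile n e (s x).
Let u n (e : R) x := s x * phi n e x.
Let b x := beta x / s x.
(* The tangential divergence of the field phi(s) (x - x0) is 2 w. *)
Let w n (e : R) x := phi n e x * (1 - u n e x ^+ n.+1.*2) +
  u n e x ^+ n.+1.*2.+1 * b x ^+ 2.

(** The field phi(s) (x - x0) is not compactly supported. For a varifold this identity comes from a
    truncated field that agrees with it on the support. *)
Hypothesis first_var : forall n (e : R), 0 < e ->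
  (\int[mu]_x (2 * w n e x)%:E = - \int[mu]_x (u n e x * b x * h x)%:E)%E.

Let le_int (f g : T -> R) : measurable_fun setT f ->
  (forall x, `|f x| <= g x) -> I g -> I f.
Proof.
move=> mf fg; apply: le_integrable => //; first exact/measurable_EFinP.
by move=> x _ /=; rewrite lee_fin (le_trans (fg x))// ler_norm.
Qed.

Let intc (M : R) : I (fun=> M).
Proof.
apply: measurable_bounded_integrable => //.
by exists `|M|; split => // y My z _ /=; exact: ltW.
Qed.

Let mphi n (e : R) : measurable_fun setT (phi n e).
Proof.
rewrite /phi /profile.
apply: (measurableT_comp (measurable_powR _)).
by apply: measurable_funD => //; exact: measurable_funX.
Qed.

Let mu_ n (e : R) : measurable_fun setT (u n e).
Proof. exact: measurable_funM. Qed.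

Let mb : measurable_fun setT b.
Proof.
apply: measurable_funM => //.
under eq_fun do rewrite -powR_inv1//.
exact: (measurableT_comp (measurable_powR _)).
Qed.

Let mw n (e : R) : measurable_fun setT (w n e).
Proof.
apply: measurable_funD; apply: measurable_funM => //; last 2 first.
- exact: measurable_funX.
- exact: measurable_funX.
- by apply: measurable_funB => //; exact: measurable_funX.
Qed.

Let phi_gt0 n (e : R) x : 0 < e -> 0 < phi n e x.
Proof. exact: profile_gt0. Qed.

Let u_ge0 n (e : R) x : 0 < e -> 0 <= u n e x.
Proof. by move=> e0; rewrite mulr_ge0// ltW// phi_gt0. Qed.

Let u_le1 n (e : R) x : 0 < e -> u n e x <= 1.
Proof. by move=> e0; exact: profile_mul_le. Qed.

Let sb2 x : s x * b x ^+ 2 <= 1.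
Proof.
rewrite /b expr_div_n; have := s0 x; rewrite le_eqVlt => /predU1P[<-|sx].
  by rewrite mul0r.
by rewrite mulrA ler_pdivrMr ?exprn_gt0// mul1r [leRHS]expr2 ler_pM2l.
Qed.

Let phib n (e : R) x : 0 < e -> u n e x * b x ^+ 2 <= phi n e x.
Proof.
move=> e0; rewrite /u mulrAC -[leRHS]mul1r ler_wpM2r// ltW//; exact: phi_gt0.
Qed.

(** With U = u^N, w is the convex combination (1 - U) phi + U (u b^2), and u b^2 <= phi because s
    b^2 <= 1. *)
Let w_ge n (e : R) x : 0 < e -> u n e x * b x ^+ 2 <= w n e x.
Proof.
move=> e0; have := phib n x e0.
have ux := u_ge0 n x e0; have ux1 := u_le1 n x e0.
have : 0 <= 1 - u n e x ^+ n.+1.*2 by rewrite subr_ge0 exprn_ile1.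
rewrite /w [_ ^+ n.+1.*2.+1]exprSr -mulrA.
set U := u n e x ^+ n.+1.*2 => U1 A.
rewrite -subr_ge0 [leRHS](_ : _ = (phi n e x - u n e x * b x ^+ 2) * (1 - U)).
  by rewrite mulr_ge0// subr_ge0.
by ring.
Qed.

Let phi_le n (e : R) x : 0 < e -> phi n e x <= e^-1.
Proof.
by move=> e0; rewrite -[leRHS]mul1r ler_pdivlMr// mulrC; exact: profile_le.
Qed.

Let ub2_ge0 n (e : R) x : 0 < e -> 0 <= u n e x * b x ^+ 2.
Proof. by move=> e0; rewrite mulr_ge0 ?sqr_ge0// u_ge0. Qed.

Let w_le n (e : R) x : 0 < e -> w n e x <= 2 / e.
Proof.
move=> e0; have := phib n x e0; have := phi_le n x e0.
have ux := u_ge0 n x e0; have ux1 := u_le1 n x e0.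
have U0 : 0 <= u n e x ^+ n.+1.*2 by rewrite exprn_ge0.
have U1 : u n e x ^+ n.+1.*2 <= 1 by rewrite exprn_ile1.
have := ub2_ge0 n x e0; have := phi_gt0 n x e0.
rewrite /w [_ ^+ n.+1.*2.+1]exprSr -mulrA.
set U := u n e x ^+ n.+1.*2 in U0 U1 *.
set A := u n e x * b x ^+ 2; nra.
Qed.

(** Young's inequality, followed by u <= 1. The weights leave coefficient 1 on u b^2, which the
    factor 2 in the first variation identity can absorb. *)
Let ubh n (e : R) x : 0 < e ->
  `|u n e x * b x * h x| <= u n e x * b x ^+ 2 + h x ^+ 2 / 4.
Proof.
move=> e0; have ux := u_ge0 n x e0; have ux1 := u_le1 n x e0.
have := sqr_ge0 (b x + h x / 2); have := sqr_ge0 (b x - h x / 2).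
have := sqr_ge0 (h x); rewrite ler_norml => A B C.
apply/andP; split; nra.
Qed.

Let Iub2 n (e : R) : 0 < e -> I (fun x => u n e x * b x ^+ 2).
Proof.
move=> e0; apply: (le_int _ _ (intc e^-1)).
  by apply: measurable_funM => //; exact: measurable_funX.
by move=> x; rewrite ger0_norm ?ub2_ge0// (le_trans (phib _ _ _))// phi_le.
Qed.

Let Iw n (e : R) : 0 < e -> I (w n e).
Proof.
move=> e0; apply: (le_int _ _ (intc (2 / e))) => // x.
by rewrite ger0_norm ?w_le// (le_trans _ (w_ge _ _ _))// ub2_ge0.
Qed.

Let Ih4 : I (fun x => h x ^+ 2 / 4).
Proof.
apply: (le_int _ _ h2).
  by apply: measurable_funM => //; exact: measurable_funX.
move=> x; have := sqr_ge0 (h x) => h0.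
by rewrite ger0_norm ?divr_ge0// ler_pdivrMr// ler_peMr// ler1n.
Qed.

Let Iubh n (e : R) : 0 < e -> I (fun x => u n e x * b x * h x).
Proof.
move=> e0; apply: (@le_int _ (fun x => u n e x * b x ^+ 2 + h x ^+ 2 / 4)).
- by do 2 apply: measurable_funM => //.
- by move=> x; exact: ubh.
- exact: (integrableD measurableT (Iub2 n e0) Ih4).
Qed.

Let first_varR n (e : R) : 0 < e ->
  2 * (\int[mu]_x w n e x) = - (\int[mu]_x (u n e x * b x * h x)).
Proof.
move=> e0; rewrite -RintegralZl//; last exact: Iw.
by rewrite /Rintegral first_var// fineN.
Qed.

(** Twice the left-hand side is at most 2 int w = - int u b h, which is at most the left-hand side
    plus int h^2 / 4; the finite common term cancels. The bound is uniform in e. *)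
Let ub2_bound n (e : R) : 0 < e ->
  \int[mu]_x (u n e x * b x ^+ 2) <= \int[mu]_x (h x ^+ 2 / 4).
Proof.
move=> e0.
have A : \int[mu]_x (u n e x * b x ^+ 2) <= \int[mu]_x w n e x.
  by apply: le_Rintegral => //; [exact: Iub2|exact: Iw|move=> x _; exact: w_ge].
have B : - (\int[mu]_x (u n e x * b x * h x)) <=
    \int[mu]_x (u n e x * b x ^+ 2) + \int[mu]_x (h x ^+ 2 / 4).
  rewrite -RintegralD//; last exact: Iub2.
  apply: le_trans (ler_norm _) _; rewrite normrN.
  apply: le_trans (le_normr_Rintegral _ _) _ => //; first exact: Iubh.
  apply: le_Rintegral => //; last by move=> x _; exact: ubh.
    exact: (integrable_abse (Iubh n e0)).
  exact: (integrableD measurableT (Iub2 n e0) Ih4).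
by have := first_varR n e0; lra.
Qed.

Let ucvg n (e : R^nat) x : (forall k, 0 < e k) -> e @ \oo --> 0 ->
  b x != 0 -> (fun k => u n (e k) x) @ \oo --> (1 : R).
Proof.
move=> e0 ecvg bx; apply: cvg_profile_mul => //.
(* Division by zero makes b vanish where s does, so b != 0 forces s > 0. *)
rewrite lt_neqAle s0 andbT; apply: contra bx => /eqP sx.
by rewrite /b -sx invr0 mulr0.
Qed.

(** Fatou's lemma along e = 1 / (k + 1) turns the uniform bound on int u b^2 into a bound on int
    b^2. Any fixed exponent would do; the smallest is taken. *)
Let Ib2 : I (fun x => b x ^+ 2).
Proof.
apply/integrableP; split; first exact/measurable_EFinP/measurable_funX.
pose e k : R := k.+1%:R^-1.
have e0 k : 0 < e k by rewrite invr_gt0.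
have ecvg : e @ \oo --> 0 by exact: cvg_harmonic.
pose f k x := (u 0 (e k) x * b x ^+ 2)%:E.
have mf k : measurable_fun setT (f k).
  by apply/measurable_EFinP/measurable_funM => //; exact: measurable_funX.
have f0 k x : setT x -> (0 <= f k x)%E by move=> _; rewrite lee_fin ub2_ge0.
have := fatou mu measurableT mf f0.
rewrite (eq_integral (fun x => (b x ^+ 2)%:E)); last first.
  move=> x _; have -> // : limn_einf (f ^~ x) = (b x ^+ 2)%:E.
  apply: (cvg_limn_einf_sup _).1; apply/fine_cvgP; split; first exact: nearW.
  suff : (fun k => u 0 (e k) x * b x ^+ 2) @ \oo --> b x ^+ 2 by [].
  have [bx|bx] := eqVneq (b x) 0.
    by rewrite bx expr0n; under eq_fun do rewrite mulr0; exact: cvg_cst.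
  by rewrite -[X in _ --> X]mul1r; apply: cvgMl; exact: ucvg.
move=> H; under eq_integral do rewrite /= ger0_norm ?sqr_ge0//.
apply: (le_lt_trans H).
apply: (@le_lt_trans _ _ (\int[mu]_x (h x ^+ 2 / 4))%:E).
  rewrite limn_einf_lim; apply: lime_le; first exact: is_cvg_einfs.
  apply: nearW => k; apply: (@le_trans _ _ (\int[mu]_x f k x)%E).
    by apply: ereal_inf_lbound; exists k => /=.
  rewrite -[leLHS]fineK; last exact: integrable_fin_num (Iub2 0 (e0 k)).
  by rewrite lee_fin; exact: ub2_bound.
by rewrite ltry.
Qed.

(** The first variation identity is split into 2 int j = - int g. Here g has an integrable bound
    uniform in e, while j is bounded only by 1 / e and carries the concentration near x0. *)
Let g n e x := u n e x * b x * h x + 2 * (u n e x ^+ n.+1.*2.+1 * b x ^+ 2).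

Let mg n (e : R) : measurable_fun setT (g n e).
Proof.
apply: measurable_funD; first by do 2 apply: measurable_funM => //.
by do 2 apply: measurable_funM => //; exact: measurable_funX.
Qed.

Let g_le n (e : R) x : 0 < e -> `|g n e x| <= 3 * b x ^+ 2 + h x ^+ 2.
Proof.
move=> e0; have ux := u_ge0 n x e0; have ux1 := u_le1 n x e0.
have U1 : u n e x ^+ n.+1.*2.+1 <= 1 by rewrite exprn_ile1.
have U0 : 0 <= u n e x ^+ n.+1.*2.+1 by rewrite exprn_ge0.
have := ubh n x e0; rewrite ler_norml => /andP[A B].
have b2 := sqr_ge0 (b x); have h2x := sqr_ge0 (h x).
rewrite ler_norml /g; set U := u n e x ^+ n.+1.*2.+1 in U0 U1 *.
by apply/andP; split; nra.
Qed.

Let Ig0 : I (fun x => 3 * b x ^+ 2 + h x ^+ 2).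
Proof.
exact: (integrableD measurableT (integrableZl measurableT 3 Ib2) h2).
Qed.

Let j n e x := phi n e x * (1 - u n e x ^+ n.+1.*2).

Let j_ge0 n (e : R) x : 0 < e -> 0 <= j n e x.
Proof.
move=> e0; rewrite mulr_ge0 ?(ltW (phi_gt0 _ _ _))// subr_ge0 exprn_ile1//.
- exact: u_ge0.
- exact: u_le1.
Qed.

Let mj n (e : R) : measurable_fun setT (j n e).
Proof.
apply: measurable_funM => //; apply: measurable_funB => //.
exact: measurable_funX.
Qed.

Let Ij n (e : R) : 0 < e -> I (j n e).
Proof.
move=> e0; apply: (le_int _ _ (Iw n e0)) => // x; rewrite ger0_norm ?j_ge0//.
by rewrite lerDl mulr_ge0 ?sqr_ge0// exprn_ge0// u_ge0.
Qed.

Let first_var_j n (e : R) : 0 < e ->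
  2 * (\int[mu]_x j n e x) = - (\int[mu]_x g n e x).
Proof.
move=> e0.
have Iu : I (fun x => u n e x ^+ n.+1.*2.+1 * b x ^+ 2).
  apply: (le_int _ _ (Iw n e0)).
    by apply: measurable_funM => //; exact: measurable_funX.
  move=> x; rewrite ger0_norm; first by rewrite lerDr j_ge0.
  by rewrite mulr_ge0 ?sqr_ge0// exprn_ge0// u_ge0.
have := first_varR n e0; rewrite /w RintegralD//; last exact: Ij.
rewrite /g RintegralD//; last 2 first.
- exact: Iubh.
- exact: (integrableZl measurableT 2 Iu).
rewrite RintegralZl// -/(j _ _); lra.
Qed.

Let L := - (\int[mu]_x (b x * h x + 2 * b x ^+ 2)).

Let Ig1 : I (fun x => b x * h x + 2 * b x ^+ 2).
Proof.
apply: (le_int _ _ Ig0).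
  apply: measurable_funD; apply: measurable_funM => //.
  exact: measurable_funX.
move=> x; rewrite ler_norml.
have := sqr_ge0 (b x + h x); have := sqr_ge0 (b x - h x).
have := sqr_ge0 (b x); have := sqr_ge0 (h x).
by move=> A B C D; apply/andP; split; nra.
Qed.

Let cvg_j n (e : R^nat) : (forall k, 0 < e k) -> e @ \oo --> 0 ->
  (fun k => 2 * (\int[mu]_x j n (e k) x)) @ \oo --> L.
Proof.
move=> e0 ecvg; under eq_fun do rewrite first_var_j//.
apply: cvgN; apply: fine_cvg; rewrite fineK; last exact: integrable_fin_num.
apply: (dominated_cvg measurableT
  (g := fun x => (3 * b x ^+ 2 + h x ^+ 2)%:E)) => //.
- by move=> k; apply/measurable_EFinP; exact: mg.
- move=> x _; apply/fine_cvgP; split; first exact: nearW.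
  suff : (fun k => g n (e k) x) @ \oo --> b x * h x + 2 * b x ^+ 2 by [].
  (* Where s = 0, u does not tend to 1, but there b = 0 and both g and its limit vanish. *)
  rewrite /g; have [bx|bx] := eqVneq (b x) 0.
    rewrite bx expr0n; under eq_fun do rewrite /= !(mulr0, mul0r).
    by rewrite !(mulr0, mul0r); exact: cvg_cst.
  have uc := ucvg n e0 ecvg bx.
  have -> : b x * h x + 2 * b x ^+ 2 =
      1 * b x * h x + 2 * (1 ^+ n.+1.*2.+1 * b x ^+ 2).
    by rewrite expr1n !mul1r.
  apply: cvgD; first by do 2 apply: cvgMl.
  by apply: cvgMr; apply: cvgMl; exact: cvg_exprn.
- by move=> k x _; rewrite lee_fin g_le.
Qed.

(** An upper density gives good radii arbitrarily close to 0, but not every small radius. *)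
Hypothesis dens : forall eta r : R, 0 < eta -> eta < 1 -> 0 < r ->
  exists2 rho : R, 0 < rho < r &
    ((eta * (pi * rho ^+ 2))%:E <= mu [set x | (s x <= rho ^+ 2)%R])%E.

(** The number l serves both as the density factor and as the ratio of the squared radius to e. On
    the ball s <= l e, [profile_lower] gives j >= c / e with c = (1 + l^N)^(-2); the ball has
    measure at least pi l^2 e, and e cancels. *)
Let j_lower n (e l : R) : 0 < e -> 0 < l ->
  ((l * (pi * (l * e)))%:E <= mu [set x | (s x <= l * e)%R])%E ->
  2 * (pi * l ^+ 2 * (1 + l ^+ n.+1.*2) ^- 2) <= 2 * (\int[mu]_x j n e x).
Proof.
move=> e0 l0 mul; rewrite ler_pM2l//.
set A := [set x | _] in mul.
have mA : measurable A.
  by rewrite -[A]setTI; apply: measurable_fun_le.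
pose c := (1 + l ^+ n.+1.*2) ^- 2.
have c0 : 0 <= c by rewrite invr_ge0 exprn_ge0// addr_ge0// exprn_ge0// ltW.
rewrite -lee_fin fineK; last exact: integrable_fin_num (Ij n e0).
apply: (@le_trans _ _ ((c / e)%:E * mu A)%E).
  apply: (@le_trans _ _ ((c / e)%:E * (l * (pi * (l * e)))%:E)%E).
    rewrite -EFinM lee_fin -/c; clearbody c.
    by rewrite le_eqVlt; apply/predU1P; left; field; rewrite gt_eqF.
  by rewrite lee_wpmul2l// lee_fin divr_ge0// ltW.
rewrite -integral_cst//.
apply: (@le_trans _ _ (\int[mu]_(x in A) (j n e x)%:E)%E).
  apply: ge0_le_integral => //.
  - by move=> x _; rewrite lee_fin divr_ge0// ltW.
  - by apply/measurable_EFinP; exact: measurable_funTS.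
  - move=> x Ax; rewrite lee_fin ler_pdivrMr// mulrC.
    by apply: profile_lower => //; rewrite ltW.
apply: ge0_subset_integral => //; first exact/measurable_EFinP.
by move=> x _; rewrite lee_fin j_ge0.
Qed.

Let L_lower n (l : R) : 0 < l -> l < 1 ->
  2 * (pi * l ^+ 2 * (1 + l ^+ n.+1.*2) ^- 2) <= L.
Proof.
move=> l0 l1.
have /choice[rho rhoP] : forall k : nat, exists rho : R, 0 < rho < k.+1%:R^-1 /\
    ((l * (pi * rho ^+ 2))%:E <= mu [set x | (s x <= rho ^+ 2)%R])%E.
  move=> k; have k0 : 0 < k.+1%:R^-1 :> R by rewrite invr_gt0.
  by have [rho ? ?] := dens l0 l1 k0; exists rho.
(* Since 2 int j tends to L along every positive null sequence, e may be adapted to the good radii,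
   so that l e_k = rho_k^2. *)
pose e k := rho k ^+ 2 / l.
have e0 k : 0 < e k.
  by have [/andP[r0 _] _] := rhoP k; rewrite divr_gt0// exprn_gt0.
have rcvg : rho @ \oo --> 0.
  apply: (@squeeze_cvgr _ _ _ _ (cst 0) (@harmonic R)).
  - by apply: nearW => k; have [/andP[/ltW r0 /ltW rk] _] := rhoP k; rewrite r0.
  - exact: cvg_cst.
  - exact: cvg_harmonic.
have ecvg : e @ \oo --> 0.
  rewrite -[X in _ --> X](_ : 0 ^+ 2 / l = 0); last by rewrite expr0n mul0r.
  by apply: cvgMl; exact: cvg_exprn.
have := cvg_j n e0 ecvg; move=> /cvg_lim <-//.
apply: limr_ge; first by apply/cvg_ex; exists L; exact: cvg_j.
apply: nearW => k; apply: j_lower => //.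
have -> : l * e k = rho k ^+ 2 by rewrite /e mulrCA divff ?mulr1// gt_eqF.
by have [_] := rhoP k.
Qed.

(** First N tends to infinity with l < 1 fixed, so that l^N tends to 0; then l tends to 1. *)
Let L_ge : 2 * pi <= L.
Proof.
have H (l : R) : 0 < l -> l < 1 -> 2 * (pi * l ^+ 2) <= L.
  move=> l0 l1; pose f n : R := 2 * (pi * l ^+ 2 * (1 + l ^+ n.+1.*2) ^- 2).
  have fcvg : f @ \oo --> 2 * (pi * l ^+ 2).
    have -> : 2 * (pi * l ^+ 2) = 2 * (pi * l ^+ 2 * (1 + 0) ^- 2).
      by rewrite addr0 expr1n invr1 mulr1.
    apply: cvgMr; apply: cvgMr; apply: cvgV.
      by rewrite addr0 expr1n oner_eq0.
    apply: cvg_exprn; apply: cvgD; first exact: cvg_cst.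
    under eq_fun do rewrite -mul2n exprM.
    have := @cvg_expr R (l ^+ 2); rewrite -cvg_shiftS; apply.
    by rewrite ger0_norm ?sqr_ge0// expr_lt1// ltW.
  move/cvg_lim : (fcvg) => <-//.
  apply: limr_le; first by apply/cvg_ex; eexists; exact: fcvg.
  by apply: nearW => n; exact: L_lower.
have pi0 := pi_gt0 R.
apply/ler_addgt0Pr => eps eps0.
(* For l = 1 - dl, 2 pi l^2 >= 2 pi - 4 pi dl >= 2 pi - eps; the bound 1 / 2 keeps l positive. *)
pose dl : R := Num.min 2^-1 (eps / (4 * pi)).
have dl0 : 0 < dl by rewrite lt_min invr_gt0 ltr0n divr_gt0// mulr_gt0.
have dl1 : dl <= 2^-1 by rewrite ge_min lexx.
have : dl * (4 * pi) <= eps.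
  by rewrite -ler_pdivlMr ?mulr_gt0// ge_min lexx orbT.
have := H (1 - dl); have := sqr_ge0 dl => dl2; rewrite subr_gt0 => /(_ _ _).
have : 0 <= pi * dl ^+ 2 by rewrite mulr_ge0// ltW.
move=> A B C; have := B (le_lt_trans dl1 _) _; nra.
Qed.

Lemma helfrich_lower_bound (c0 : R) : c0 < 0 ->
  (0 < - \int[mu]_x (beta x / s x)%:E)%E ->
  ((4 * pi)%:E < (4^-1)%:E * \int[mu]_x ((h x - c0) ^+ 2)%:E)%E.
Proof.
move=> c00 vol.
have Ib : I b.
  apply: (@le_int _ (fun x => 1 + b x ^+ 2)) => //.
    move=> x; have := sqr_ge0 (b x - 1); have := sqr_ge0 (b x + 1).
    by rewrite ler_norml => A B; apply/andP; split; nra.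
  exact: (integrableD measurableT (intc 1) Ib2).
have Ihc : I (fun x => (h x - c0) ^+ 2).
  apply: (@le_int _ (fun x => 2 * c0 ^+ 2 + 2 * h x ^+ 2)).
  - by apply: measurable_funX; exact: measurable_funB.
  - move=> x; have A := sqr_ge0 (h x + c0).
    by rewrite ger0_norm ?sqr_ge0//; lra.
  - exact: (integrableD measurableT (intc _) (integrableZl measurableT 2 h2)).
have Ihc8 : I (fun x => 8^-1 * (h x - c0) ^+ 2).
  exact: (integrableZl measurableT _ Ihc).
have Icb : I (fun x => c0 * b x) by exact: (integrableZl measurableT _ Ib).
have /= H : 0 <= \int[mu]_x (8^-1 * (h x - c0) ^+ 2 +
    ((b x * h x + 2 * b x ^+ 2) - c0 * b x)).
  apply: Rintegral_ge0 => x _.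
  (* The integrand is exactly half of this square. *)
  by have := sqr_ge0 (2 * b x + (h x - c0) / 2); lra.
rewrite RintegralD// in H; last exact: (integrableB measurableT Ig1 Icb).
rewrite RintegralB// !RintegralZl// in H.
have /= volR : \int[mu]_x b x < 0.
  rewrite -oppr_gt0 -fineN -lte_fin fineK// fin_numN.
  exact: integrable_fin_num.
rewrite -[X in (_ < _ * X)%E]fineK; last exact: integrable_fin_num.
rewrite -EFinM lte_fin -/(Rintegral _ _ _).
have := L_ge; rewrite /L.
(* The nonlinear ingredient is c0 int b > 0, a product of two negative numbers; it makes the
   inequality strict. *)
by nra.
Qed.

End monotonicity.

(** * Oriented planes in R^3 *)

Section euclidean_lemmas.
Context {R : realType}.
Implicit Types (u v x y : 'rV[R]_3) (xi : 'M[R]_3) (nu : 'rV[R]_3).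

Lemma dot3E u v : dot u v = u 0 0 * v 0 0 + u 0 1 * v 0 1 + u 0 2 * v 0 2.
Proof.
rewrite /dot !big_ord_recl big_ord0 addr0 addrA.
by congr (_ * _ + u 0 _ * v 0 _ + u 0 _ * v 0 _); apply/val_inj.
Qed.

Lemma rV3P u v : u 0 0 = v 0 0 -> u 0 1 = v 0 1 -> u 0 2 = v 0 2 -> u = v.
Proof.
move=> e0 e1 e2; apply/rowP => -[[|[|[|//]]] i3].
- by rewrite (_ : Ordinal i3 = 0)//; apply/val_inj.
- by rewrite (_ : Ordinal i3 = 1)//; apply/val_inj.
- by rewrite (_ : Ordinal i3 = 2)//; apply/val_inj.
Qed.

Lemma dotE u v : dot u v = (u *m v^T) 0 0.
Proof. by rewrite mxE; apply: eq_bigr => i _; rewrite mxE. Qed.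

Lemma mulmx_trE m n (A : 'M[R]_(m, 3)) (B : 'M[R]_(n, 3)) i k :
  (A *m B^T) i k = dot (row i A) (row k B).
Proof. by rewrite !mxE; apply: eq_bigr => j _; rewrite !mxE. Qed.

Lemma dotC u v : dot u v = dot v u.
Proof. by apply: eq_bigr => i _; rewrite mulrC. Qed.

Lemma dotDl u v x : dot (u + v) x = dot u x + dot v x.
Proof. by rewrite !dot3E !mxE; ring. Qed.

Lemma dotZl (a : R) u v : dot (a *: u) v = a * dot u v.
Proof. by rewrite !dot3E !mxE; ring. Qed.

Lemma dotBZ u v (c : R) : dot (u - c *: v) (u - c *: v) =
  dot u u - 2 * c * dot u v + c ^+ 2 * dot v v.
Proof. by rewrite !dot3E !mxE; ring. Qed.

Lemma dot_ge0 u : 0 <= dot u u.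
Proof. by apply: sumr_ge0 => i _; rewrite -expr2 sqr_ge0. Qed.

Lemma enorm_sqr u : enorm u ^+ 2 = dot u u.
Proof. by rewrite sqr_sqrtr// dot_ge0. Qed.

Lemma cross3E u v : (cross u v 0 0 = u 0 1 * v 0 2 - u 0 2 * v 0 1) *
  (cross u v 0 1 = u 0 2 * v 0 0 - u 0 0 * v 0 2) *
  (cross u v 0 2 = u 0 0 * v 0 1 - u 0 1 * v 0 0).
Proof. by rewrite !mxE. Qed.

Lemma tangent_wedge u v :
  tangent (wedge u v) = [set x | dot x (cross u v) = 0].
Proof.
apply/funext => x; rewrite /tangent /mkset/= /wedge12 dot3E !cross3E !mxE.
by congr (_ = _); ring.
Qed.

Lemma norm2_wedge u v : norm2 (wedge u v) = enorm (cross u v).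
Proof.
rewrite /norm2 /enorm; congr (Num.sqrt _).
under eq_bigr do rewrite big_mkcond !big_ord_recl big_ord0.
rewrite !big_ord_recl big_ord0 /= dot3E !cross3E !mxE.
have -> : lift ord0 (lift ord0 ord0) = 2 :> 'I_3 by apply/val_inj.
have -> : lift ord0 ord0 = 1 :> 'I_3 by apply/val_inj.
have -> : ord0 = 0 :> 'I_3 by apply/val_inj.
ring.
Qed.

Lemma oGrass_cross (xi : oGrass R) : exists u v,
  set_val xi = wedge u v /\ dot (cross u v) (cross u v) = 1.
Proof.
have [[u [v xiE]] n1] : oGrass_set (set_val xi) := set_mem (valP xi).
move: n1; rewrite xiE norm2_wedge => n1; exists u, v; split => //.
by rewrite -enorm_sqr n1 expr1n.
Qed.

Lemma dot_hodge (xi : oGrass R) :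
  dot (hodge (set_val xi)) (hodge (set_val xi)) = 1.
Proof. by have [u [v [-> uv1]]] := oGrass_cross xi; rewrite hodge_wedge. Qed.

Lemma tangentE (xi : oGrass R) :
  tangent (set_val xi) = [set x | dot x (hodge (set_val xi)) = 0].
Proof.
by have [u [v [-> uv1]]] := oGrass_cross xi; rewrite tangent_wedge hodge_wedge.
Qed.

(** The square matrix E with rows e_1, e_2, nu satisfies E E^T = 1, hence also E^T E = 1, which is
    the resolution of the identity. *)
Lemma orthonormal_resolution nu (e : 'M[R]_(2, 3)) : dot nu nu = 1 ->
  (forall j k, dot (row j e) (row k e) = (j == k)%:R) ->
  (forall j, dot (row j e) nu = 0) ->
  forall x, x = x *m e^T *m e + dot x nu *: nu.
Proof.
move=> nu1 ee enu x; pose E : 'M[R]_(2 + 1, 3) := col_mx e nu.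
have EE : E *m E^T = 1%:M.
  rewrite /E tr_col_mx mul_col_row (_ : 1%:M = block_mx 1%:M 0 0 1%:M).
    congr block_mx.
    - by apply/matrixP => j k; rewrite mulmx_trE ee !mxE.
    - by apply/colP => j; rewrite mulmx_trE row_id enu mxE.
    - by apply/rowP => j; rewrite mulmx_trE row_id dotC enu mxE.
    - by apply/rowP => j; rewrite mulmx_trE !ord1 row_id nu1 mxE.
  by rewrite -scalar_mx_block.
have := mulmx1C EE; rewrite /E tr_col_mx mul_row_col => E1.
rewrite -[LHS]mulmx1 -E1 mulmxDr !mulmxA; congr (_ + _).
by rewrite [x *m nu^T]mx11_scalar -dotE mul_scalar_mx.
Qed.

Lemma wedge_eq u v u' v' : cross u v = cross u' v' -> wedge u v = wedge u' v'.
Proof.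
move=> uv; have c i : cross u v 0 i = cross u' v' 0 i by rewrite uv.
have := c 0; have := c 1; have := c 2; rewrite !cross3E => c2 c1 c0.
have I3 (i : 'I_3) : [\/ i = 0, i = 1 | i = 2].
  by case: i => -[|[|[|//]]] ?; [apply: Or31|apply: Or32|apply: Or33];
    apply/val_inj.
apply/matrixP => i j; rewrite !mxE.
by case: (I3 i) => ->; case: (I3 j) => ->; lra.
Qed.

(** Take e_1 = u / |u| and e_2 = nu x e_1; then e_1 x e_2 = nu because e_1 is a unit vector
    orthogonal to nu. This serves both for tangent bases and for the compactness of the
    Grassmannian. *)
Lemma orthonormal_factor u v : dot (cross u v) (cross u v) = 1 ->
  exists e1 e2, [/\ dot e1 e1 = 1, dot e2 e2 = 1, dot e1 e2 = 0 &
    cross e1 e2 = cross u v].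
Proof.
set nu := cross u v => nu1.
have unu : dot u nu = 0 by rewrite /nu dot3E !cross3E; ring.
have u0 : 0 < dot u u.
  rewrite lt_neqAle dot_ge0 andbT; apply/eqP => /esym/eqP.
  rewrite dot3E !paddr_eq0 ?addr_ge0 -?expr2 ?sqr_ge0// !sqrf_eq0.
  move=> /andP[/andP[/eqP z0 /eqP z1] /eqP z2].
  move/eqP: nu1; rewrite dot3E !cross3E z0 z1 z2.
  by rewrite !(mul0r, subr0, addr0) eq_sym oner_eq0.
pose r := Num.sqrt (dot u u); have r2 : r ^+ 2 = dot u u by rewrite enorm_sqr.
have r0 : r != 0 by rewrite gt_eqF// sqrtr_gt0.
pose e1 := r^-1 *: u.
have e11 : dot e1 e1 = 1 by rewrite /e1 dotZl dotC dotZl -r2; field.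
have e1nu : dot e1 nu = 0 by rewrite dotZl unu mulr0.
exists e1, (cross nu e1); split => //.
- transitivity (dot nu nu * dot e1 e1 - dot e1 nu ^+ 2).
    by rewrite !dot3E !cross3E; ring.
  by rewrite nu1 e11 e1nu expr0n subr0 mulr1.
- by rewrite dot3E !cross3E; ring.
- transitivity (dot e1 e1 *: nu - dot e1 nu *: e1).
    by apply: rV3P; rewrite !dot3E !cross3E !mxE /=; ring.
  by rewrite e11 e1nu scale1r scale0r subr0.
Qed.

Lemma exists_orthonormal_basis u v : dot (cross u v) (cross u v) = 1 ->
  exists e, orthonormal_basis [set x | dot x (cross u v) = 0] e.
Proof.
move=> /[dup] nu1 /orthonormal_factor[e1 [e2 [e11 e22 e12 e12nu]]].
set nu := cross u v in nu1 e12nu *.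
pose e : 'M[R]_(2, 3) := \matrix_j [:: e1; e2]`_j.
have re0 : row 0 e = e1 by rewrite rowK.
have re1 : row 1 e = e2 by rewrite rowK.
have e1nu : dot e1 nu = 0 by rewrite -e12nu dot3E !cross3E; ring.
have e2nu : dot e2 nu = 0 by rewrite -e12nu dot3E !cross3E; ring.
have I2 (j : 'I_2) : j = 0 \/ j = 1.
  by case: j => -[|[|//]] ?; [left|right]; apply/val_inj.
have ee j k : dot (row j e) (row k e) = (j == k)%:R.
  by case: (I2 j) => ->; case: (I2 k) => ->; rewrite ?re0 ?re1 // dotC.
have enu j : dot (row j e) nu = 0 by case: (I2 j) => ->; rewrite ?re0 ?re1.
exists e; split => //; apply/seteqP; split => x /=.
  move=> xnu; rewrite (orthonormal_resolution nu1 ee enu x) xnu scale0r addr0.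
  exact: submxMl.
move=> /submxP[D ->]; rewrite dotE -mulmxA (_ : e *m nu^T = 0) ?mulmx0 ?mxE//.
by apply/colP => j; rewrite mulmx_trE row_id enu mxE.
Qed.

(** The basis chosen by [xget] in [tdiv] is unknown; these two facts hold for every orthonormal
    basis, and they suffice to compute the divergence of a radial field. *)
Lemma tangent_basis (xi : oGrass R) (nu := hodge (set_val xi))
    (e := xget 0 (orthonormal_basis (tangent (set_val xi)))) :
  (forall j, dot (row j e) (row j e) = 1) /\
  forall x, \sum_(j < 2) dot x (row j e) ^+ 2 = dot x x - dot x nu ^+ 2.
Proof.
have [e0 e0P] : exists e, orthonormal_basis (tangent (set_val xi)) e.
  have [u [v [-> uv1]]] := oGrass_cross xi.
  by rewrite tangent_wedge; exact: exists_orthonormal_basis.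
have [ee eT] : orthonormal_basis (tangent (set_val xi)) e.
  by apply: xgetPex; exists e0.
have enu j : dot (row j e) nu = 0.
  have : [set v | (v <= e)%MS] (row j e) by exact: row_sub.
  by rewrite -eT tangentE.
split => [j|x]; first by rewrite ee eqxx.
have := orthonormal_resolution (dot_hodge xi) ee enu x; rewrite -/nu => xE.
have -> : dot x x = dot (x *m e^T *m e + dot x nu *: nu) x by rewrite -xE.
rewrite dotDl dotZl (dotC nu) -expr2 addrK.
rewrite dotE -mulmxA mxE; apply: eq_bigr => j _.
by rewrite !mulmx_trE !row_id (dotC (row j e)).
Qed.

Lemma dot_sqr_le x nu : dot nu nu = 1 -> dot x nu ^+ 2 <= dot x x.
Proof.
by move=> nu1; have := dot_ge0 (x - dot x nu *: nu); rewrite dotBZ nu1; lra.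
Qed.

Lemma parallel_to_unit u nu : dot nu nu = 1 -> wedge u nu = 0 ->
  u = dot u nu *: nu.
Proof.
move=> nu1 /matrixP unu.
have e01 := unu 0 1; have e02 := unu 0 2; have e12 := unu 1 2.
move: e01 e02 e12 nu1; rewrite !mxE !dot3E => e01 e02 e12 nu1.
have z (a b : R) : a = 0 -> a * b = 0 by move=> ->; rewrite mul0r.
(* Writing u_i as u_i |nu|^2 makes the goal a linear combination of the three relations multiplied
   by the coordinates of nu, as [lra] requires. *)
have := (z _ (nu 0 0) e01, z _ (nu 0 1) e01, z _ (nu 0 2) e01).
have := (z _ (nu 0 0) e02, z _ (nu 0 1) e02, z _ (nu 0 2) e02).
have := (z _ (nu 0 0) e12, z _ (nu 0 1) e12, z _ (nu 0 2) e12).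
move=> [[? ?] ?] [[? ?] ?] [[? ?] ?].
by apply: rV3P; rewrite !mxE -[LHS]mulr1 -nu1; lra.
Qed.

End euclidean_lemmas.

(** * Radial test fields *)

Section matrix_topology.
Context {R : realType}.

Lemma mx_continuous m n (T : topologicalType) (f : T -> 'M[R]_(m, n)) :
  (forall i j, continuous (fun t => f t i j)) -> continuous f.
Proof.
move=> fc t; apply/cvg_ballP => e e0.
suff : \forall t' \near t, forall i j, ball (f t i j) e (f t' i j).
  by apply: filterS => t' H; split.
apply: filter_forall => i; apply: filter_forall => j.
by have /cvg_ballP := fc i j t; apply.
Qed.

End matrix_topology.

Section radial_field.
Context {R : realType}.
Variables (x0 : 'rV[R]_3) (g dg : R -> R).
Hypothesis gdg : forall t : R, is_derive t 1 g (dg t).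

Definition sqdist (x : 'rV[R]_3) : R := dot (x - x0) (x - x0).

Definition radial (x : 'rV[R]_3) : 'rV[R]_3 := g (sqdist x) *: (x - x0).

Lemma is_diff_coord (x : 'rV[R]_3) i :
  is_diff x (fun y : 'rV[R]_3 => (y - x0) 0 i) (fun v => v 0 i).
Proof.
pose f (N : 'rV[R]_3) : R := N 0 i.
have f_lin : linear f by move=> a u v; rewrite /f !mxE.
pose fM := GRing.isLinear.Build _ _ _ _ _ f_lin.
pose fL : {linear 'rV[R]_3 -> R} := HB.pack f fM.
have fc : continuous fL by move=> y; exact: coord_continuous.
have dfL : is_diff x fL fL.
  by apply: DiffDef; [exact: linear_differentiable|rewrite diff_lin].
have df : is_diff x f f := dfL.
have -> : (fun y : 'rV[R]_3 => (y - x0) 0 i) = f - cst (x0 0 i).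
  by apply/funext => y; rewrite !fctE !mxE.
by apply: is_diff_eq; rewrite subr0.
Qed.

Lemma is_diff_sqdist (x : 'rV[R]_3) :
  is_diff x sqdist (fun v => 2 * dot (x - x0) v).
Proof.
have d i := is_diff_coord x i.
have -> : sqdist = (fun y => (y - x0) 0 0) * (fun y => (y - x0) 0 0) +
    (fun y => (y - x0) 0 1) * (fun y => (y - x0) 0 1) +
    (fun y => (y - x0) 0 2) * (fun y => (y - x0) 0 2).
  by apply/funext => y; rewrite /sqdist dot3E !fctE.
have dM i := is_diffM (d i) (d i).
apply: (is_diff_eq (is_diffD (is_diffD (dM 0) (dM 1)) (dM 2))).
apply/funext => v.
by rewrite !fctE /GRing.scale/= dot3E; ring.
Qed.

Lemma is_diff_radial (x : 'rV[R]_3) : is_diff x radial (fun v =>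
  (2 * dg (sqdist x) * dot (x - x0) v) *: (x - x0) + g (sqdist x) *: v).
Proof.
have ds := is_diff_sqdist x.
have dgs : is_diff x (g \o sqdist)
    (fun v => dg (sqdist x) * (2 * dot (x - x0) v)).
  have dg1 : is_diff (sqdist x) g (fun t => t * dg (sqdist x)).
    have [dd de] := gdg (sqdist x).
    apply: DiffDef; first exact/derivable1_diffP.
    by rewrite diff1E; [rewrite derive1E de|exact/derivable1_diffP].
  by apply: is_diff_eq; apply/funext => v /=; rewrite mulrC.
have d i := is_diff_coord x i.
(* The field is split along the coordinate axes, so that only products of scalar functions have to
   be differentiated. *)
pose k i : 'rV[R]_3 -> R := (g \o sqdist) * (fun y => (y - x0) 0 i).
pose K i := ( *:%R ^~ (delta_mx 0 i : 'rV[R]_3)) \o k i.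
have -> : radial = K 0 + K 1 + K 2.
  apply/funext => y; rewrite /K /k /radial !fctE.
  by apply: rV3P; rewrite !mxE /=; ring.
have dk i : is_diff x (k i) (fun v => g (sqdist x) * v 0 i +
    (x - x0) 0 i * (dg (sqdist x) * (2 * dot (x - x0) v))).
  by apply: is_diff_eq; apply/funext => v; rewrite !fctE.
have dK i : is_diff x (K i) (fun v => (g (sqdist x) * v 0 i +
    (x - x0) 0 i * (dg (sqdist x) * (2 * dot (x - x0) v))) *: delta_mx 0 i).
  exact: (is_diff_comp (dk i) (is_diff_scalel (k i x) (delta_mx 0 i))).
apply: (is_diff_eq (is_diffD (is_diffD (dK 0) (dK 1)) (dK 2))).
by apply/funext => v; rewrite !fctE; apply: rV3P; rewrite !mxE /=; ring.
Qed.

Lemma tdiv_radial (xi : oGrass R) (x : 'rV[R]_3) :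
  tdiv (tangent (set_val xi)) radial x =
  2 * (g (sqdist x) + dg (sqdist x) *
    (sqdist x - dot (x - x0) (hodge (set_val xi)) ^+ 2)).
Proof.
have [ee eP] := tangent_basis xi.
rewrite /tdiv; set e := xget _ _ in ee eP *.
have [_ ->] := is_diff_radial x.
under eq_bigr => j _.
  rewrite /= (dotC (row j e)) [dot _ _]dotDl !dotZl ee mulr1 -mulrA -expr2.
  over.
by rewrite big_split/= sumr_const card_ord -mulr_sumr eP /sqdist; ring.
Qed.

Hypothesis dg_cont : continuous dg.

Lemma sqdist_continuous : continuous sqdist.
Proof.
by move=> x; apply/differentiable_continuous; have [] := is_diff_sqdist x.
Qed.

Lemma closed_sqdist_le (M : R) : closed [set x | sqdist x <= M].
Proof.
apply: (preimage_closed (D := `]-oo, M]%classic)) => // y _.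
exact: sqdist_continuous.
Qed.

Lemma compact_sqdist_le (M : R) : compact [set x | sqdist x <= M].
Proof.
(* This choice gives M <= c^2, so the Euclidean ball lies in the cube of half-side c. *)
pose c := `|M| + 1.
have box : compact [set v : 'rV[R]_3 | forall i,
    v ord0 i \in `[(x0 0 i - c), (x0 0 i + c)]].
  apply: (@rV_compact _ _ (fun i => `[(x0 0 i - c), (x0 0 i + c)]%classic)).
  by move=> i; exact: segment_compact.
apply: (subclosed_compact (@closed_sqdist_le M) box) => x /= xM i.
have H : (x 0 i - x0 0 i) ^+ 2 <= c ^+ 2.
  apply: (@le_trans _ _ M).
    apply: le_trans xM; rewrite /sqdist /dot (bigD1 i)//= !mxE -expr2 lerDl.
    by apply: sumr_ge0 => k _; rewrite -expr2 sqr_ge0.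
  rewrite /c; have := ler_norm M; have := normr_ge0 M; nra.
have c0 : 0 <= c by rewrite addr_ge0.
rewrite -[leLHS]real_normK ?num_real// in H.
move: H; rewrite ler_sqr ?nnegrE// ler_norml in_itv/= => /andP[A B].
by apply/andP; split; lra.
Qed.

Lemma radial_C1c (M : R) : (forall t, M <= t -> g t = 0) -> C1c radial.
Proof.
move=> gM; split.
- by move=> x; have [] := is_diff_radial x.
- have sc := sqdist_continuous.
  have gc : continuous g.
    move=> t; apply/differentiable_continuous/derivable1_diffP.
    by have [] := gdg t.
  apply: mx_continuous => i j.
  have -> : (fun x => 'J radial x i j) = (fun x =>
    2 * dg (sqdist x) * (x - x0) 0 i * (x - x0) 0 j +
    g (sqdist x) * (i == j)%:R).
    apply/funext => x; rewrite mxE; have [_ ->] := is_diff_radial x.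
    rewrite !mxE eqxx /= (eq_sym j); congr (2 * _ * _ * _ + _).
    rewrite /dot (bigD1 i)//= big1 ?addr0 ?mxE ?eqxx ?mulr1// => k ki.
    by rewrite !mxE (negPf ki) andbF mulr0.
  have cc k : continuous (fun x : 'rV[R]_3 => (x - x0) 0 k : R).
    by move=> x; apply/differentiable_continuous; have [] := is_diff_coord x k.
  have dgc x : (fun y => dg (sqdist y)) @ x --> dg (sqdist x).
    exact: (continuous_comp (sc x) (@dg_cont (sqdist x))).
  have ggc x : (fun y => g (sqdist y)) @ x --> g (sqdist x).
    exact: (continuous_comp (sc x) (gc (sqdist x))).
  move=> x; exact: (cvgD
    (cvgM (cvgM (cvgM (cvg_cst _) (dgc x)) (cc i x)) (cc j x))
    (cvgM (ggc x) (cvg_cst _))).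
- apply: (subclosed_compact _ (@compact_sqdist_le M)).
    exact: closed_closure.
  rewrite [X in _ `<=` X](closure_id _).1; last exact: closed_sqdist_le.
  apply: closureS => x /=.
  apply: contraNT; rewrite -ltNge => Mx.
  by rewrite /radial gM ?scale0r ?ltW.
Qed.

End radial_field.

(** * A continuously differentiable cutoff function *)

Section cutoff.
Context {R : realType}.

Definition sqpos (t : R) : R := Num.max t 0 ^+ 2.

Lemma is_derive_sqpos (t : R) : is_derive t 1 sqpos (2 * Num.max t 0).
Proof.
(* A quadratic bound on the first-order Taylor remainder covers the corner of the positive part at 0
   together with the smooth cases. *)
have quad (h : R) :
    `|sqpos (h + t) - sqpos t - h * (2 * Num.max t 0)| <= h ^+ 2.
  rewrite /sqpos ler_norml.
  apply/andP; split; case: (leP t 0) => t0.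
  - by case: (leP (h + t) 0) => ht0; nra.
  - by case: (leP (h + t) 0) => ht0; nra.
  - by case: (leP (h + t) 0) => ht0; nra.
  - by case: (leP (h + t) 0) => ht0; nra.
have H : (fun h => h^-1 *: (sqpos (h *: 1 + t) - sqpos t)) @ 0^' -->
    2 * Num.max t 0.
  apply/cvgrPdist_le => eps eps0; near=> h.
  have h0 : h != 0 by near: h; exact: nbhs_dnbhs_neq.
  have heps : `|h| <= eps by near: h; exact: dnbhs0_le.
  rewrite distrC /GRing.scale/= mulr1; apply: le_trans heps.
  have -> : h^-1 * (sqpos (h + t) - sqpos t) - 2 * Num.max t 0 =
      h^-1 * (sqpos (h + t) - sqpos t - h * (2 * Num.max t 0)) by field.
  rewrite normrM normfV mulrC ler_pdivrMr ?normr_gt0// -normrM -expr2.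
  by rewrite [leRHS]ger0_norm ?sqr_ge0.
apply: DeriveDef; first by apply/cvg_ex; eexists; exact: H.
exact/cvg_lim.
Unshelve. all: end_near. Qed.

Lemma max0_continuous : continuous (fun t : R => Num.max t 0).
Proof. by move=> t; apply: continuous_max => //; exact: cvg_cst. Qed.

Lemma sqpos_continuous : continuous sqpos.
Proof.
move=> t; apply/differentiable_continuous/derivable1_diffP.
by have [] := is_derive_sqpos t.
Qed.

(** The inner square is 0 for t <= M and at least 1 for t >= M + 1, so this falls from 1 to 0 on
    [M, M + 1] and is of class C^1. *)
Definition cutoff (M t : R) : R := sqpos (1 - sqpos (t - M)).

Definition dcutoff (M t : R) : R :=
  - (4 * Num.max (1 - sqpos (t - M)) 0 * Num.max (t - M) 0).

Lemma is_derive_cutoff (M t : R) : is_derive t 1 (cutoff M) (dcutoff M t).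
Proof.
have d1 : is_derive t 1 (fun t => t - M) 1.
  have -> : (fun t : R => t - M) = id - cst M by [].
  by apply: is_derive_eq; rewrite subr0.
have d2 : is_derive t 1 (fun t => 1 - sqpos (t - M))
    (- (2 * Num.max (t - M) 0)).
  have d3 := @is_derive1_comp _ sqpos (fun t => t - M) _ _ _
    (is_derive_sqpos (t - M)) d1.
  have -> : (fun t => 1 - sqpos (t - M)) = cst 1 - (sqpos \o (fun t => t - M)).
    by [].
  by apply: is_derive_eq; rewrite mulr1 sub0r.
have := @is_derive1_comp _ sqpos (fun t => 1 - sqpos (t - M)) _ _ _
  (is_derive_sqpos (1 - sqpos (t - M))) d2.
by congr is_derive; rewrite /dcutoff; ring.
Qed.

Lemma dcutoff_continuous (M : R) : continuous (dcutoff M).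
Proof.
have d1 : continuous (fun t : R => t - M).
  by move=> t; apply: cvgB => //; exact: cvg_cst.
have sM : continuous (sqpos \o (fun t : R => t - M)).
  by move=> t; apply: continuous_comp; [exact: d1|exact: sqpos_continuous].
have d2 : continuous (fun t : R => 1 - sqpos (t - M)).
  by move=> t; apply: cvgB; [exact: cvg_cst|exact: sM].
have m1 : continuous ((fun u : R => Num.max u 0) \o (fun t : R => t - M)).
  by move=> t; apply: continuous_comp; [exact: d1|exact: max0_continuous].
have m2 : continuous ((fun u : R => Num.max u 0) \o
    (fun t : R => 1 - sqpos (t - M))).
  by move=> t; apply: continuous_comp; [exact: d2|exact: max0_continuous].
by move=> t; apply: cvgN; apply: (cvgM (cvgM (cvg_cst _) (m2 t)) (m1 t)).
Qed.

Lemma sqpos0 (t : R) : t <= 0 -> sqpos t = 0.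
Proof. by move=> t0; rewrite /sqpos max_r// expr0n. Qed.

Lemma cutoff_eq1 (M t : R) : t <= M -> cutoff M t = 1.
Proof.
move=> tM; rewrite /cutoff (@sqpos0 (t - M)) ?subr_le0// subr0 /sqpos max_l//.
by rewrite expr1n.
Qed.

Lemma dcutoff_eq0 (M t : R) : t <= M -> dcutoff M t = 0.
Proof.
move=> tM; rewrite /dcutoff [Num.max (t - M) 0]max_r ?subr_le0//.
by rewrite mulr0 oppr0.
Qed.

Lemma cutoff_eq0 (M t : R) : M + 1 <= t -> cutoff M t = 0.
Proof.
move=> tM; rewrite /cutoff sqpos0// subr_le0 /sqpos max_l; last lra.
by rewrite exprn_ege1//; lra.
Qed.

End cutoff.

(** * The truncated profile *)

Section cutoff_profile.
Context {R : realType}.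
Variables (n : nat) (e M : R).
Hypothesis e0 : 0 < e.

Definition cprofile (t : R) := profile n e t * cutoff M t.

Definition dcprofile (t : R) := profile n e t * dcutoff M t +
  cutoff M t * - (t ^+ n.+1.*2.-1 * profile n e t ^+ n.+1.*2.+1).

Lemma is_derive_cprofile (t : R) : is_derive t 1 cprofile (dcprofile t).
Proof. exact: is_deriveM (is_derive_profile n t e0) (is_derive_cutoff M t). Qed.

Lemma profile_continuous : continuous (profile n e).
Proof.
move=> t; apply/differentiable_continuous/derivable1_diffP.
by have [] := is_derive_profile n t e0.
Qed.

Lemma dcprofile_continuous : continuous dcprofile.
Proof.
have cc : continuous (cutoff M).
  move=> t; apply/differentiable_continuous/derivable1_diffP.
  by have [] := is_derive_cutoff M t.
have px (k : nat) : continuous (fun t => profile n e t ^+ k).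
  move=> t; apply: (continuous_comp (g := fun u : R => u ^+ k)).
    exact: profile_continuous.
  exact: exprn_continuous.
move=> t; apply: cvgD.
  by apply: (cvgM (@profile_continuous t) (@dcutoff_continuous _ M t)).
apply: cvgM; first exact: cc.
by apply: cvgN; apply: cvgM; [exact: exprn_continuous|exact: px].
Qed.

Lemma cprofile_eq0 (t : R) : M + 1 <= t -> cprofile t = 0.
Proof. by move=> tM; rewrite /cprofile cutoff_eq0// mulr0. Qed.

(** Below M the cutoff is 1 with zero derivative, and inserting phi' = - s^(N-1) phi^(N+1) leaves
    algebra. By [tdiv_radial] the left-hand side is half the tangential divergence. *)
Lemma cprofile_identity (s beta : R) : 0 <= s -> s <= M -> beta ^+ 2 <= s ->
  cprofile s + dcprofile s * (s - beta ^+ 2) =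
  profile n e s * (1 - (s * profile n e s) ^+ n.+1.*2) +
  (s * profile n e s) ^+ n.+1.*2.+1 * (beta / s) ^+ 2.
Proof.
move=> s0 sM bs; rewrite /cprofile /dcprofile cutoff_eq1// dcutoff_eq0//.
rewrite mulr0 add0r mul1r mulr1; set p := profile n e s.
(* At s = 0 the bound on beta forces beta = 0, and the convention for division by zero is
   harmless. *)
move: s0; rewrite le_eqVlt => /predU1P[s0|s0].
  rewrite -s0 in bs *; have -> : beta ^+ 2 = 0.
    by apply/le_anti; rewrite bs sqr_ge0.
  by rewrite subr0 mulr0 mul0r !expr0n/= mul0r !(addr0, subr0, mulr1).
have NE : n.+1.*2 = n.+1.*2.-1.+1 by [].
set N := n.+1.*2.-1 in NE *; rewrite NE !exprMn !exprS exprVn.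
by field; rewrite gt_eqF.
Qed.

End cutoff_profile.

(** * Supports and finiteness of Radon varifolds *)

Lemma continuous_measurable_borel (R : realType) (T : ptopologicalType)
    (f : T -> R) :
  continuous f -> measurable_fun [set: borel T] (f : borel T -> R).
Proof.
move=> cf; apply: (measurability _ (RGenOpens.measurableE R)).
move=> _ [_ [a [b ->]] <-]; rewrite setTI; apply: sub_sigma_algebra.
by move/continuousP : cf; apply; exact: interval_open.
Qed.

Lemma hausdorff_inj (X Y : topologicalType) (f : X -> Y) :
  continuous f -> injective f -> hausdorff_space Y -> hausdorff_space X.
Proof.
move=> cf fI hY p q pq; apply: fI; apply: hY => A B Ap Bq.
have [x [Ax Bx]] := pq _ _ (cf p _ Ap) (cf q _ Bq).
by exists (f x).
Qed.

Lemma compact_set_type (X : topologicalType) (A : set X) :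
  compact A -> compact [set: set_type A].
Proof.
move=> cA F PF _; pose G := set_val @ F.
have GA : G A.
  by apply: (@filterS _ F _ setT) filterT => x _; exact: (set_mem (valP x)).
have [p [Ap Gp]] := cA G _ GA.
exists (exist _ p (mem_set Ap)); split => // B C FB.
case=> _ /= [] [W oW <-] /= Wp WC.
have GB : G (set_val @` B).
  by apply: (@filterS _ F _ B) FB => x Bx; exists x.
have [_ [[x Bx <-] Wx]] := Gp _ W GB (open_nbhs_nbhs (conj oW Wp)).
by exists x; split => //; exact: WC.
Qed.

(** * Compactness of the oriented Grassmannian *)

Section compact_grassmannian.
Context {R : realType}.

Lemma continuous_coord (T : topologicalType) m n (f : T -> 'M[R]_(m, n)) i j :
  continuous f -> continuous (fun t => f t i j).
Proof.
move=> cf t; apply: (@continuous_comp _ _ _ f (fun M : 'M[R]_(m, n) => M i j)).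
  exact: cf.
exact: coord_continuous.
Qed.

Lemma continuous_dot (T : topologicalType) (f g : T -> 'rV[R]_3) :
  continuous f -> continuous g -> continuous (fun t => dot (f t) (g t)).
Proof.
move=> cf cg; under eq_fun do rewrite dot3E.
move=> t; apply: cvgD; first apply: cvgD.
- by apply: cvgM; exact: continuous_coord.
- by apply: cvgM; exact: continuous_coord.
- by apply: cvgM; exact: continuous_coord.
Qed.

Definition orthonormal_pair : set ('rV[R]_3 * 'rV[R]_3) :=
  [set p | [/\ dot p.1 p.1 = 1, dot p.2 p.2 = 1 & dot p.1 p.2 = 0]].

Lemma compact_orthonormal_pair : compact orthonormal_pair.
Proof.
have cB := @compact_sqdist_le R 0 1.
apply: (subclosed_compact _ (compact_setX cB cB)) => [|[u v] [/= u1 v1 _]].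
  have c1 : continuous (@fst 'rV[R]_3 'rV[R]_3) by move=> p; exact: cvg_fst.
  have c2 : continuous (@snd 'rV[R]_3 'rV[R]_3) by move=> p; exact: cvg_snd.
  rewrite (_ : orthonormal_pair = (fun p => dot p.1 p.1) @^-1` [set 1] `&`
    ((fun p => dot p.2 p.2) @^-1` [set 1] `&`
     (fun p => dot p.1 p.2) @^-1` [set 0])).
    apply: closedI; last apply: closedI.
    - apply: preimage_closed; last exact: closed_eq.
      by move=> p _; exact: (continuous_dot c1 c1).
    - apply: preimage_closed; last exact: closed_eq.
      by move=> p _; exact: (continuous_dot c2 c2).
    - apply: preimage_closed; last exact: closed_eq.
      by move=> p _; exact: (continuous_dot c1 c2).
  by apply/seteqP; split => p [] // a [].
by rewrite /sqdist !subr0 u1 v1.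
Qed.

Lemma continuous_wedge :
  continuous (fun p : 'rV[R]_3 * 'rV[R]_3 => wedge p.1 p.2).
Proof.
apply: mx_continuous => i j.
have -> : (fun p : 'rV[R]_3 * 'rV[R]_3 => wedge p.1 p.2 i j) =
    (fun p => p.1 0 i * p.2 0 j - p.1 0 j * p.2 0 i).
  by apply/funext => p; rewrite mxE.
have c1 k : continuous (fun p : 'rV[R]_3 * 'rV[R]_3 => p.1 0 k).
  by apply: continuous_coord => p; exact: cvg_fst.
have c2 k : continuous (fun p : 'rV[R]_3 * 'rV[R]_3 => p.2 0 k).
  by apply: continuous_coord => p; exact: cvg_snd.
move=> p; apply: cvgB; apply: cvgM.
- exact: c1.
- exact: c2.
- exact: c1.
- exact: c2.
Qed.

(** This exhibits the Grassmannian as a continuous image of a compact set. One inclusion is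
    [orthonormal_factor], the other is Lagrange's identity for |u x v|^2. *)
Lemma oGrass_setE :
  @oGrass_set R = (fun p => wedge p.1 p.2) @` orthonormal_pair.
Proof.
apply/seteqP; split => [xi [[u [v ->]]]|_ [[u v] /= [u1 v1 uv] <-]].
  rewrite norm2_wedge => nu1.
  have {}nu1 : dot (cross u v) (cross u v) = 1 by rewrite -enorm_sqr nu1 expr1n.
  have [e1 [e2 [e11 e22 e12 enu]]] := orthonormal_factor nu1.
  by exists (e1, e2) => //=; exact: wedge_eq.
split; first by exists u, v.
rewrite norm2_wedge /enorm.
have -> : dot (cross u v) (cross u v) = dot u u * dot v v - dot u v ^+ 2.
  by rewrite !dot3E !cross3E; ring.
by rewrite u1 v1 uv expr0n subr0 mulr1 sqrtr1.
Qed.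

Lemma compact_oGrass : compact [set: oGrass R].
Proof.
apply: compact_set_type; rewrite oGrass_setE; apply: continuous_compact.
  exact/continuous_subspaceT/continuous_wedge.
exact: compact_orthonormal_pair.
Qed.

End compact_grassmannian.

Lemma radon_open (R : realType) (T : ptopologicalType)
    (mu : {measure set (borel T) -> \bar R}) : radon mu ->
  forall U : set T, open U ->
    mu U = ereal_sup [set mu K | K in [set K : set T | compact K /\ K `<=` U]].
Proof. by case. Qed.

Lemma radon_compact (R : realType) (T : ptopologicalType)
    (mu : {measure set (borel T) -> \bar R}) : radon mu ->
  forall K : set T, compact K -> (mu K < +oo)%E.
Proof. by case. Qed.

Lemma open_measurable_borel (T : ptopologicalType) (U : set T) :
  open U -> measurable (U : set (borel T)).
Proof. by move=> oU; apply: sub_sigma_algebra. Qed.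

Section support.
Context {R : realType}.
Variable V : {measure set (G2o R) -> \bar R}.
Hypothesis radonV : radon V.
Local Notation G := ('rV[R]_3 * oGrass R)%type.

Let V_open (U : set G) : open U ->
  V U = ereal_sup [set V K | K in [set K : set G | compact K /\ K `<=` U]].
Proof. exact: (radon_open radonV). Qed.

Let V_compact (K : set G) : compact K -> (V K < +oo)%E.
Proof. exact: (radon_compact radonV). Qed.

Lemma plane_continuous : continuous (fun p : G => plane p).
Proof.
move=> p; apply: (@continuous_comp _ _ _ (@snd 'rV[R]_3 (oGrass R)) set_val).
  exact: cvg_snd.
exact: initial_continuous.
Qed.

Lemma base_continuous : continuous (fun p : G => base p : 'rV[R]_3).
Proof. by move=> p; exact: cvg_fst. Qed.

Lemma hausdorff_G2o : hausdorff_space G.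
Proof.
apply: (@hausdorff_inj _ ('rV[R]_3 * 'M[R]_3)%type
  (fun p : G => (base p : 'rV[R]_3, plane p))).
- move=> p; exact: (cvg_pair (@base_continuous p) (@plane_continuous p)).
- move=> [x xi] [y yi] [xy xiE]; congr pair; first exact: xy.
  exact: val_inj xiE.
- exact: norm_hausdorff.
Qed.

Lemma open_setC_spt : open (~` spt (weight V)).
Proof. by rewrite setCK; apply: bigcup_open => U []. Qed.

(* Inner regularity reduces the claim to compact sets, which finitely many of
   the null open sets cover. *)
Lemma weight_setC_spt : weight V (~` spt (weight V)) = 0%E.
Proof.
set O := ~` _; have oO : open O := open_setC_spt.
have oB : open (base @^-1` O : set G).
  by apply: open_comp oO => p _; exact: base_continuous.
rewrite -[LHS]/(V (base @^-1` O)) V_open//.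
apply/eqP; rewrite eq_le; apply/andP; split; last first.
  apply: ereal_sup_ubound; exists set0; last by rewrite measure0.
  by split; [exact: compact0|exact: sub0set].
apply: ge_ereal_sup => _ [K [cK KO] <-].
have cbK : compact (base @` K : set 'rV[R]_3).
  apply: continuous_compact cK; apply: continuous_subspaceT.
  exact: base_continuous.
pose D := [set U : set 'rV[R]_3 | open U /\ weight V U = 0%E].
move: cbK; rewrite compact_cover => /(_ _ D id) [].
- by move=> U [].
- move=> _ [p Kp <-]; have := KO p Kp.
  by rewrite /O /spt setCK.
move=> D' D'D bKD'.
pose W := \bigcup_(U in [set` D']) U.
have [mW W0] : measurable (W : set (E3 R)) /\ weight V W = 0%E.
  rewrite /W bigcup_fset big_seq.
  apply: (@big_ind _ (fun A : set 'rV[R]_3 =>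
    measurable (A : set (E3 R)) /\ weight V A = 0%E)).
  - by split; [exact: measurable0|exact: measure0].
  - move=> A B [mA A0] [mB B0]; split; first exact: measurableU.
    apply/eqP; rewrite -measure_le0.
    apply: (@le_trans _ _ (weight V A + weight V B)%E); first exact: measureU2.
    by rewrite A0 B0 adde0.
  - move=> U /D'D /set_mem [oU U0].
    by split => //; exact: open_measurable_borel.
have mK : measurable (K : set (G2o R)).
  rewrite -[K]setCK; apply: measurableC; apply: open_measurable_borel.
  by rewrite openC; exact: compact_closed hausdorff_G2o cK.
apply: (@le_trans _ _ (V (base @^-1` W))).
  apply: le_measure; [exact: mem_set|apply: mem_set|].
    by rewrite -[_ @^-1` _]setTI; exact: measurable_base.
  by move=> p Kp; apply: bKD'; exists p.
by rewrite -[X in (X <= _)%E]/(weight V W) W0.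
Qed.

Hypothesis cspt : compact (spt (weight V)).

Lemma measurable_setC_spt : measurable (~` spt (weight V) : set (E3 R)).
Proof. by apply: open_measurable_borel; exact: open_setC_spt. Qed.

Lemma ae_base_spt : {ae V, forall p, spt (weight V) (base p)}.
Proof.
exists (base @^-1` (~` spt (weight V))); split => //.
- rewrite -[_ @^-1` _]setTI; apply: measurable_base => //.
  exact: measurable_setC_spt.
- exact: weight_setC_spt.
Qed.

(** Over the support lies its product with the compact Grassmannian, a compact set and so of finite
    measure; the rest is null. *)
Lemma varifold_finite : (V setT < +oo)%E.
Proof.
have mC : measurable (base @^-1` (~` spt (weight V)) : set (G2o R)).
  rewrite -[_ @^-1` _]setTI; apply: measurable_base => //.
  exact: measurable_setC_spt.
have -> : [set: G2o R] =
    (base @^-1` (spt (weight V))) `|` (base @^-1` (~` spt (weight V))).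
  by rewrite preimage_setC setUv.
have mS : measurable (base @^-1` (spt (weight V)) : set (G2o R)).
  by rewrite -[_ @^-1` _]setCK -preimage_setC; exact: measurableC.
apply: le_lt_trans (measureU2 _ mS mC) _.
rewrite [X in (_ + X)%E](_ : _ = 0%E); last exact: weight_setC_spt.
rewrite adde0; apply: V_compact.
rewrite (_ : _ @^-1` _ = spt (weight V) `*` [set: oGrass R]).
  exact: compact_setX cspt compact_oGrass.
by apply/seteqP; split => p //= [].
Qed.

End support.

(** * Integrals against the weight measure, and the density hypothesis *)

Section pushforward_and_density.
Context {R : realType}.
Variable V : {measure set (G2o R) -> \bar R}.
Local Notation G := ('rV[R]_3 * oGrass R)%type.

Lemma integral_weight (f : E3 R -> \bar R) : measurable_fun setT f ->
  (\int[weight V]_x f x = \int[V]_p f (base p))%E.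
Proof.
move=> mf; rewrite integralE [RHS]integralE.
have P (g : E3 R -> \bar R) : measurable_fun setT g -> (forall x, 0 <= g x)%E ->
    (\int[weight V]_x g x = \int[V]_p g (base p))%E.
  move=> mg g0.
  exact: (@ge0_integral_pushforward _ _ _ _ R base measurable_base V setT g).
congr (_ - _)%E.
  have := P (f^\+)%E (measurable_funepos mf) (fun x => funepos_ge0 f x).
  by move=> ->; apply: eq_integral => p _; rewrite !unlock.
have := P (f^\-)%E (measurable_funeneg mf) (fun x => funeneg_ge0 f x).
by move=> ->; apply: eq_integral => p _; rewrite !unlock.
Qed.

(** The upper limit is an infimum, over neighbourhoods, of suprema; on the neighbourhood (0, r) the
    supremum is therefore at least 1 > eta. *)
Lemma upper_density2_witness (x0 : 'rV[R]_3) (eta r : R) :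
  (1 <= upper_density2 (weight V) x0)%E -> eta < 1 -> 0 < r ->
  exists2 rho : R, 0 < rho < r &
    ((eta * (pi * rho ^+ 2))%:E <=
     V [set p | (sqdist x0 (base p) <= rho ^+ 2)%R])%E.
Proof.
move=> dens eta1 r0.
pose f (rho : R) := (weight V (eball x0 rho) * ((pi * rho ^+ 2)^-1)%:E)%E.
pose A := [set rho : R | 0 < rho < r].
have FA : (0%R : R)^'+ A.
  near=> rho; apply/andP; split; last by near: rho; exact: nbhs_right_lt.
  by near: rho; exact: nbhs_right_gt.
have : (eta%:E < ereal_sup (f @` A))%E.
  apply: (@lt_le_trans _ _ 1%E); first by rewrite lte_fin.
  by apply: le_trans dens _; apply: ereal_inf_lbound; exists A.
move=> /ereal_sup_gt[_ [rho /andP[rho0 rhor] <-]] fr.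
exists rho; first by rewrite rho0.
have -> : [set p : G2o R | sqdist x0 (base p) <= rho ^+ 2] =
    base @^-1` (eball x0 rho).
  have E (p : G2o R) :
      (sqdist x0 (base p) <= rho ^+ 2) = (enorm (base p - x0) <= rho).
    by rewrite -[RHS]ler_sqr ?nnegrE ?sqrtr_ge0 ?(ltW rho0)// enorm_sqr.
  by apply/seteqP; split => p; rewrite /eball /mkset /= E.
move: fr; rewrite /f -[V _]/(weight V (eball x0 rho)).
have c0 : 0 < pi * rho ^+ 2 by rewrite mulr_gt0 ?pi_gt0 ?exprn_gt0.
move: (weight V (eball x0 rho)) => [m| |] //=.
- by rewrite -EFinM lte_fin lee_fin ltr_pdivlMr// => /ltW.
- by rewrite leey.
- by rewrite gt0_mulNye// lte_fin invr_gt0.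
Unshelve. all: end_near. Qed.

End pushforward_and_density.

(** * Measurability of the geometric integrands *)

Section measurability.
Context {R : realType}.

Lemma measurable_dot d (T : measurableType d) (f g : T -> 'rV[R]_3) :
  (forall i, measurable_fun setT (fun t => f t 0 i)) ->
  (forall i, measurable_fun setT (fun t => g t 0 i)) ->
  measurable_fun setT (fun t => dot (f t) (g t)).
Proof.
move=> mf mg; under eq_fun do rewrite dot3E.
by apply: measurable_funD; first apply: measurable_funD; apply: measurable_funM.
Qed.

Lemma continuous_measurable_G2o (f : 'rV[R]_3 * oGrass R -> R) :
  continuous f -> measurable_fun setT (f : G2o R -> R).
Proof. exact: continuous_measurable_borel. Qed.

Lemma measurable_coord i : measurable_fun setT (fun x : E3 R => x 0 i : R).
Proof.
by apply: continuous_measurable_borel => x; exact: coord_continuous.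
Qed.

Lemma continuous_hodge (T : topologicalType) (f : T -> 'M[R]_3) :
  continuous f -> continuous (fun t => hodge (f t)).
Proof.
move=> cf; apply: mx_continuous => i j; rewrite ord1.
have -> : (fun t => hodge (f t) 0 j) =
    (fun t => f t (nth 0 [:: 1; 2; 0] j) (nth 0 [:: 2; 0; 1] j)).
  by apply/funext => t; rewrite mxE; case: j => -[|[|[|//]]].
exact: continuous_coord.
Qed.

End measurability.

Theorem lemma6p1 (R : realType) (V : {measure set (G2o R) -> \bar R})
    (H : E3 R -> E3 R) (c0 : R) (x0 : 'rV[R]_3) :
  radon V ->
  L2loc (weight V) H ->
  (forall X : 'rV[R]_3 -> 'rV[R]_3, C1c X ->
     first_variation V X = (- \int[weight V]_x (dot (X x) (H x))%:E)%E) ->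
  {ae V, forall p, wedge (H (base p)) (hodge (plane p)) = 0} ->
  compact (spt (weight V)) ->
  c0 < 0 ->
  (1 <= upper_density2 (weight V) x0)%E ->
  (0 < conc_volume V x0)%E ->
  ((4 * pi)%:E < helfrich c0 V H)%E.
Proof.
move=> radonV [mH H2] fv aeH cspt c0_lt0 dens vol.
pose s (p : G2o R) := sqdist x0 (base p).
pose beta (p : G2o R) := dot (base p - x0) (hodge (plane p)).
pose h (p : G2o R) := dot (H (base p)) (hodge (plane p)).
have Vfin := varifold_finite radonV cspt.
have ae_spt := ae_base_spt radonV.
have csub : continuous
    (fun p : 'rV[R]_3 * oGrass R => (base p - x0 : 'rV[R]_3)).
  by move=> p; apply: cvgB; [exact: base_continuous|exact: cvg_cst].
have chodge : continuous (fun p : 'rV[R]_3 * oGrass R => hodge (plane p)).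
  by apply: continuous_hodge; exact: plane_continuous.
have ms : measurable_fun setT s.
  exact: (continuous_measurable_G2o (continuous_dot csub csub)).
have mbeta : measurable_fun setT beta.
  exact: (continuous_measurable_G2o (continuous_dot csub chodge)).
have mHi i : measurable_fun setT (fun p : G2o R => H (base p) 0 i).
  apply: (measurableT_comp (measurable_coord i)).
  exact: (measurableT_comp mH measurable_base).
have mhodge i : measurable_fun setT (fun p : G2o R => hodge (plane p) 0 i).
  by apply: continuous_measurable_G2o; exact: continuous_coord.
have mh : measurable_fun setT h by exact: measurable_dot.
have mHH : measurable_fun setT (fun p : G2o R => dot (H (base p)) (H (base p))).
  exact: measurable_dot.
have hodge1 (p : G2o R) : dot (hodge (plane p)) (hodge (plane p)) = 1.
  exact: dot_hodge.
have s_ge0 p : 0 <= s p by exact: dot_ge0.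
have beta_le p : beta p ^+ 2 <= s p by exact: dot_sqr_le.
(* By Cauchy-Schwarz h^2 <= |H|^2. The integral of |H|^2 passes to the weight measure, where it
   lives on the compact support, and there H is square integrable. *)
have Ih2 : V.-integrable setT (EFin \o (fun p => h p ^+ 2)).
  have mHE : measurable_fun setT (fun x : E3 R => dot (H x) (H x)).
    by apply: measurable_dot => i;
      exact: (measurableT_comp (measurable_coord i)).
  apply: (@le_integrable _ _ _ _ _ measurableT _
    (fun p => (dot (H (base p)) (H (base p)))%:E)).
  - exact/measurable_EFinP/measurable_funX.
  - move=> p _ /=; rewrite lee_fin !ger0_norm ?sqr_ge0 ?dot_ge0//.
    exact: dot_sqr_le.
  apply/integrableP; split; first exact/measurable_EFinP.
  under eq_integral do rewrite gee0_abs ?lee_fin ?dot_ge0//.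
  rewrite -(@integral_weight _ _ (fun x => (dot (H x) (H x))%:E)); last first.
    exact/measurable_EFinP.
  rewrite (ge0_negligible_integral (measurable_setC_spt V)) //; last 3 first.
  - exact/measurable_EFinP.
  - by move=> x _; rewrite lee_fin dot_ge0.
  - exact: weight_setC_spt.
  rewrite setTD setCK; apply: le_lt_trans (H2 _ cspt).
  by under [leRHS]eq_integral do rewrite enorm_sqr.
have hE : {ae V, forall p, H (base p) = h p *: hodge (plane p)}.
  by apply: filterS aeH => p; exact: parallel_to_unit.
(* With this M the cutoff equals 1 on the support. *)
have [M sM] : exists M, forall x, spt (weight V) x -> sqdist x0 x <= M.
  have : compact (sqdist x0 @` spt (weight V)).
    apply: continuous_compact cspt; apply: continuous_subspaceT.
    exact: sqdist_continuous.
  move=> /compact_bounded[M [_ HM]]; exists (M + 1) => x xspt.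
  apply: le_trans (ler_norm _) _; apply: HM; first by rewrite ltrDl.
  by exists x.
have ident n (e : R) : 0 < e ->
  (\int[V]_x (2 * (profile n e (s x) *
      (1 - (s x * profile n e (s x)) ^+ n.+1.*2) +
      (s x * profile n e (s x)) ^+ n.+1.*2.+1 * (beta x / s x) ^+ 2))%:E =
   - \int[V]_x (s x * profile n e (s x) * (beta x / s x) * h x)%:E)%E.
  move=> e0; pose g := cprofile n e M; pose X := radial x0 g.
  have mp : measurable_fun setT (fun p => profile n e (s p)).
    apply: (measurableT_comp _ ms).
    by apply: continuous_measurable_fun; exact: profile_continuous.
  have mu : measurable_fun setT (fun p => s p * profile n e (s p)).
    exact: measurable_funM.
  have mb : measurable_fun setT (fun p => beta p / s p).
    apply: measurable_funM => //; under eq_fun do rewrite -powR_inv1//.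
    exact: (measurableT_comp (measurable_powR _)).
  have tdivE (p : G2o R) : tdiv (tangent (plane p)) X (base p) =
      2 * (g (s p) + dcprofile n e M (s p) * (s p - beta p ^+ 2)).
    exact: (tdiv_radial _ (is_derive_cprofile n M e0) p.2 (base p)).
  have mg : measurable_fun setT (fun p => g (s p)).
    apply: (measurableT_comp _ ms); apply: continuous_measurable_fun => t.
    apply/differentiable_continuous/derivable1_diffP.
    by have [] := is_derive_cprofile n M e0 t.
  have mdg : measurable_fun setT (fun p => dcprofile n e M (s p)).
    apply: (measurableT_comp _ ms).
    by apply: continuous_measurable_fun; exact: dcprofile_continuous.
  (* Almost every base point lies in the support, where the divergence of the truncated field agrees
     with that of the untruncated one. *)
  transitivity (first_variation V X).
    apply: ae_eq_integral => //.
    - apply/measurable_EFinP; apply: measurable_funM => //.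
      apply: measurable_funD; apply: measurable_funM => //.
      + by apply: measurable_funB => //; exact: measurable_funX.
      + exact: measurable_funX.
      + exact: measurable_funX.
    - under eq_fun do rewrite tdivE.
      apply/measurable_EFinP; apply: measurable_funM => //.
      apply: measurable_funD => //; apply: measurable_funM => //.
      by apply: measurable_funB => //; exact: measurable_funX.
    - apply: filterS ae_spt => p pspt _; rewrite tdivE.
      by rewrite (cprofile_identity n e (s_ge0 p) (sM _ pspt) (beta_le p)).
  have XC : C1c X.
    apply: (radial_C1c x0 (is_derive_cprofile n M e0) _
      (@cprofile_eq0 _ n e M)).
    by move=> t; exact: dcprofile_continuous.
  rewrite fv//.
  have mXE : measurable_fun setT (fun x : E3 R => dot (X x) (H x)).
    apply: measurable_dot => i; last first.
      exact: (measurableT_comp (measurable_coord i)).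
    apply: continuous_measurable_borel; apply: continuous_coord => x.
    by apply/differentiable_continuous; have [] := XC.
  congr (- _)%E; rewrite integral_weight; last exact/measurable_EFinP.
  apply: ae_eq_integral => //.
  - apply/measurable_EFinP; exact: (measurableT_comp mXE measurable_base).
  - by apply/measurable_EFinP; do 2 apply: measurable_funM => //.
  - apply: filterS2 hE ae_spt => p HE pspt _; congr EFin.
    rewrite HE dotZl dotC dotZl dotC -/(beta p) /g /cprofile.
    rewrite -[sqdist _ _]/(s p) cutoff_eq1 ?mulr1; last exact: sM.
    have := s_ge0 p; rewrite le_eqVlt => /predU1P[sp|sp].
      have -> : beta p = 0.
        by apply/eqP; rewrite -sqrf_eq0 eq_le sqr_ge0 andbT sp beta_le.
      by rewrite !(mulr0, mul0r).
    by field; rewrite gt_eqF.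
have densV eta r : 0 < eta -> eta < 1 -> 0 < r -> exists2 rho : R, 0 < rho < r &
    ((eta * (pi * rho ^+ 2))%:E <= V [set p | (s p <= rho ^+ 2)%R])%E.
  by move=> _ eta1 r0; exact: upper_density2_witness.
have volV : (0 < - \int[V]_p (beta p / s p)%:E)%E.
  move: vol; rewrite /conc_volume; under eq_integral do rewrite enorm_sqr.
  by [].
have := helfrich_lower_bound Vfin ms mbeta mh s_ge0 beta_le Ih2 ident densV
  c0_lt0 volV.
(* Almost everywhere H = h nu with nu a unit vector, so |H - c0 nu|^2 = (h - c0)^2. *)
congr (_ < _ * _)%E; apply: ae_eq_integral => //.
- by apply/measurable_EFinP/measurable_funX/measurable_funB.
- apply/measurable_EFinP; under eq_fun do rewrite enorm_sqr dotBZ hodge1.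
  apply: measurable_funD => //; apply: measurable_funB => //.
  exact: measurable_funM.
- apply: filterS hE => p /= -> _; congr EFin.
  by rewrite enorm_sqr -scalerBl dotZl dotC dotZl hodge1 mulr1 -expr2.
Qed.
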